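(* Let $\{(y^k,z^k,x^k)\}$ be an infinite sequence generated by the inexact augmented Lagrangian method (described in the context) under the stopping criterion $$(A')\quad \|\nabla\psi_k(y^{k+1})\|\le \varepsilon_k/\sqrt{\sigma_k}\quad\text{for all } k\ge 0 .$$ Then the sequence $\{x^k\}$ converges to some $\bar x\in\Omega_P$, and the sequence $\{(y^k,z^k)\}$ converges to the unique optimal solution of $(D)$. Furthermore, if the criterion $$(B')\quad \|\nabla\psi_k(y^{k+1})\|\le (\delta_k/\sqrt{\sigma_k})\,\|x^{k+1}-x^k\|\quad\text{for all } k\ge 0$$ is also executed and the initial point $x^0\in\mathbb{R}^n$ satisfies $\mathrm{dist}(x^0,\Omega_P)\le r-\alpha$, then for all $k\ge 0$, $$\mathrm{dist}(x^{k+1},\Omega_P)\le \mu_k\,\mathrm{dist}(x^k,\Omega_P),$$ $$\|\mathcal{A}^*y^{k+1}+z^{k+1}\|\le \mu_k'\,\mathrm{dist}(x^k,\Omega_P),$$ $$\sup(D)-g(y^{k+1},z^{k+1})\le \mu_k''\,\mathrm{dist}(x^k,\Omega_P),$$ where $$\mu_k:=\Big[\delta_k+(1+\delta_k)\kappa/\sqrt{\kappa^2+\sigma_k^2}\Big]/(1-\delta_k),\qquad \mu_k':=1/[(1-\delta_k)\sigma_k],$$ $$\mu_k'':=\big[\delta_k^2\|x^{k+1}-x^k\|+\|x^{k+1}\|+\|x^k\|\big]/[2(1-\delta_k)\sigma_k].$$ Moreover, $\mu_k$, $\mu_k'$ and $\mu_k''$ go to $0$ if $\sigma_k\uparrow\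sigma_\infty=+\infty$.
   Context: Setting. $\mathcal{A}:\mathbb{R}^n\to\mathbb{R}^m$ is linear with adjoint $\mathcal{A}^*$, $b\in\mathbb{R}^m$, $\lambda_1\ge0$, $\lambda_2\ge 0$ with $\lambda_1+\lambda_2>0$. The index sets $G_1,\dots,G_g$ form a partition of $\{1,\dots,n\}$, $w_l>0$ for $l=1,\dots,g$, and $x_{G_l}$ is the restriction of $x$ to $G_l$. $\|\cdot\|$ is the Euclidean norm. Put $$p(x):=\lambda_1\|x\|_1+\lambda_2\sum_{l=1}^g w_l\|x_{G_l}\|,\qquad f(x):=\tfrac12\|\mathcal{A}x-b\|^2,\qquad h:=f+p.$$ $p^*(z)=\sup_x\{\langle x,z\rangle-p(x)\}$ is the conjugate of $p$. For a closed proper convex function $q$, $\mathrm{Prox}_q(u):=\arg\min_x\{q(x)+\frac12\|x-u\|^2\}$. $\mathrm{dist}(x,\Omega):=\inf_{x'\in\Omega}\|x-x'\|$. Problems. $(P)$: $\min_{x\in\mathbb{R}^n}h(x)$, with optimal solution set $\Omega_P$ (a nonempty compact convex set). $(D)$: maximize $g(y,z):=-\langle b,y\rangle-\frac12\|y\|^2-p^*(z)$ over $(y,z)\in\mathbb{R}^m\times\mathbb{R}^n$ subject to $\mathcal{A}^*y+z=0$; $\sup(D)$ is its optimal value. (The letter $g$ denotes the number of groups in the definition of $p$ and the dual objective function in $g(y,z)$.) Algorithm (inexact augmented Lagrangian method). For $\sigma>0$ let $$\mathcal{L}_\sigma(y,z;x):=\langle b,y\rangle+\tfrac12\|y\|^2+p^*(z)+\tfrac{\sigma}{2}\|\mathcal{A}^*y+z-\sigma^{-1}x\|^2-\tfrac{1}{2\sigma}\|x\|^2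 .$$ Start from $\sigma_0>0$ and $(y^0,z^0,x^0)\in\mathbb{R}^m\times\mathbb{R}^n\times\mathbb{R}^n$. For $k=0,1,\dots$: let $\psi_k(y):=\inf_z\mathcal{L}_{\sigma_k}(y,z;x^k)$ (a strongly convex, continuously differentiable function of $y$); choose $y^{k+1}$ as an approximate minimizer of $\psi_k$ (accuracy governed by the stopping criteria in the claim); set $$z^{k+1}=\mathrm{Prox}_{p^*/\sigma_k}(\sigma_k^{-1}x^k-\mathcal{A}^*y^{k+1}),\qquad x^{k+1}=x^k-\sigma_k(\mathcal{A}^*y^{k+1}+z^{k+1});$$ and choose $\sigma_{k+1}$ so that the sequence $\{\sigma_k\}$ is nondecreasing with limit $\sigma_\infty\le\infty$. Constants. $\{\varepsilon_k\}$ and $\{\delta_k\}$ are given nonnegative summable sequences with $\delta_k<1$ for all $k\ge0$. $\alpha$ is a scalar with $\sum_{k=0}^\infty\varepsilon_k\le\alpha$, and $r$ is any positive scalar with $r>\alpha$. Let $\mathcal{T}(x):=\nabla f(x)+\partial p(x)\subseteq\mathbb{R}^n$, where $\partial p$ is the convex subdifferential. $\kappa>0$ is a constant (which exists for every such $r$) such that $$\mathrm{dist}(x,\Omega_P)\le\kappa\,\mathrm{dist}(0,\mathcal{T}(x))\quad\text{for all }x\in\mathbb{R}^n\text{ with }\mathrm{dist}(x,\Omega_P)\le r .$$ *)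

(* Defs.v *)
From mathcomp Require Import all_boot all_order all_algebra.
From mathcomp Require Import all_classical all_reals all_analysis.

Set Implicit Arguments.
Unset Strict Implicit.
Unset Printing Implicit Defensive.

Import Order.TTheory GRing.Theory Num.Theory.
Import numFieldNormedType.Exports.

Local Open Scope classical_set_scope.
Local Open Scope ring_scope.

Definition dot (R : realType) (n : nat) (u v : 'cV[R]_n) : R :=
  \sum_(i < n) u i 0 * v i 0.

(* The norm that the library puts on matrices, [`|x|], is the maximum norm;
   hence a separate Euclidean norm. Both induce the topology used for [-->]. *)
Definition enorm (R : realType) (n : nat) (x : 'cV[R]_n) : R :=
  Num.sqrt (dot x x).

Definition norm1 (R : realType) (n : nat) (x : 'cV[R]_n) : R :=
  \sum_(i < n) `|x i 0|.

(* [inf set0 = 0] by convention: only meaningful for a nonempty [Omega]. The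
   sets to which it is applied are the solution set of (P) and
   [nabla f x + subdiff p x], which are both nonempty. *)
Definition dist (R : realType) (n : nat) (x : 'cV[R]_n)
    (Omega : set 'cV[R]_n) : R :=
  inf [set enorm (x - x') | x' in Omega].

Definition is_adjoint (R : realType) (n m : nat)
    (A : 'cV[R]_n -> 'cV[R]_m) (Astar : 'cV[R]_m -> 'cV[R]_n) : Prop :=
  forall x y, dot (A x) y = dot x (Astar y).

Definition restr (R : realType) (n : nat) (x : 'cV[R]_n) (G : {set 'I_n}) :
    'cV[R]_#|G| :=
  \col_(j < #|G|) x (enum_val j) 0.

(* Vector of partial derivatives. *)
Definition grad (R : realType) (n : nat) (F : 'cV[R]_n -> R)
    (x : 'cV[R]_n) : 'cV[R]_n :=
  \col_(i < n) 'D_(delta_mx i 0) (F : 'cV[R]_n -> R^o) x.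

Definition subdiff (R : realType) (n : nat) (q : 'cV[R]_n -> R)
    (x : 'cV[R]_n) : set 'cV[R]_n :=
  [set v | forall x', q x + dot v (x' - x) <= q x'].

Definition conjugate (R : realType) (n : nat) (q : 'cV[R]_n -> R)
    (z : 'cV[R]_n) : \bar R :=
  ereal_sup [set (dot x z - q x)%:E | x in [set: 'cV[R]_n]].

Definition argmin (R : realType) (T : Type) (F : T -> \bar R) : set T :=
  [set x | forall x', (F x <= F x')%E].

(* For [q] closed proper convex the set of minimizers is a singleton, so that
   the default value [u] is not used. *)
Definition Prox (R : realType) (n : nat) (q : 'cV[R]_n -> \bar R)
    (u : 'cV[R]_n) : 'cV[R]_n :=
  xget u (argmin (fun x => q x + (2^-1 * enorm (x - u) ^+ 2)%:E)%E).

Definition reg (R : realType) (n g : nat) (lambda1 lambda2 : R)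
    (G : 'I_g -> {set 'I_n}) (w : 'I_g -> R) (x : 'cV[R]_n) : R :=
  lambda1 * norm1 x + lambda2 * \sum_(l < g) w l * enorm (restr x (G l)).

Definition lsq (R : realType) (n m : nat) (A : 'cV[R]_n -> 'cV[R]_m)
    (b : 'cV[R]_m) (x : 'cV[R]_n) : R :=
  2^-1 * enorm (A x - b) ^+ 2.

Definition primal_opt (R : realType) (n : nat) (h : 'cV[R]_n -> R) :
    set 'cV[R]_n :=
  argmin (EFin \o h).

Definition dual_obj (R : realType) (n m : nat) (b : 'cV[R]_m)
    (pstar : 'cV[R]_n -> \bar R) (yz : 'cV[R]_m * 'cV[R]_n) : \bar R :=
  ((- dot b yz.1 - 2^-1 * enorm yz.1 ^+ 2)%:E - pstar yz.2)%E.

Definition dual_feasible (R : realType) (n m : nat)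
    (Astar : 'cV[R]_m -> 'cV[R]_n) : set ('cV[R]_m * 'cV[R]_n) :=
  [set yz | Astar yz.1 + yz.2 = 0].

Definition dual_opt (R : realType) (n m : nat)
    (Astar : 'cV[R]_m -> 'cV[R]_n) (b : 'cV[R]_m)
    (pstar : 'cV[R]_n -> \bar R) : set ('cV[R]_m * 'cV[R]_n) :=
  [set yz | dual_feasible Astar yz /\
    forall yz', dual_feasible Astar yz' ->
      (dual_obj b pstar yz' <= dual_obj b pstar yz)%E].

Definition dual_sup (R : realType) (n m : nat)
    (Astar : 'cV[R]_m -> 'cV[R]_n) (b : 'cV[R]_m)
    (pstar : 'cV[R]_n -> \bar R) : \bar R :=
  ereal_sup [set dual_obj b pstar yz | yz in dual_feasible Astar].

Definition auglag (R : realType) (n m : nat)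
    (Astar : 'cV[R]_m -> 'cV[R]_n) (b : 'cV[R]_m)
    (pstar : 'cV[R]_n -> \bar R) (sigma : R)
    (y : 'cV[R]_m) (z x : 'cV[R]_n) : \bar R :=
  ((dot b y + 2^-1 * enorm y ^+ 2)%:E + pstar z +
   (sigma / 2 * enorm (Astar y + z - sigma^-1 *: x) ^+ 2
    - (2 * sigma)^-1 * enorm x ^+ 2)%:E)%E.

(* The infimum over z is finite for every y when [sigma > 0], so that [fine]
   only changes its type; [grad] needs a real-valued function. *)
Definition psi (R : realType) (n m : nat)
    (Astar : 'cV[R]_m -> 'cV[R]_n) (b : 'cV[R]_m)
    (pstar : 'cV[R]_n -> \bar R) (sigma : R) (x : 'cV[R]_n)
    (y : 'cV[R]_m) : R :=
  fine (ereal_inf [set auglag Astar b pstar sigma y z x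
                  | z in [set: 'cV[R]_n]]).

(* The inexactness of y^(k+1) is governed by the stopping criteria, which are
   stated separately. *)
Definition ialm_sequence (R : realType) (n m : nat)
    (Astar : 'cV[R]_m -> 'cV[R]_n) (pstar : 'cV[R]_n -> \bar R)
    (sigma : nat -> R) (y : nat -> 'cV[R]_m) (z x : nat -> 'cV[R]_n) : Prop :=
  [/\ 0 < sigma 0%N,
      nondecreasing_seq sigma,
      (forall k, z k.+1 =
         Prox (fun z' => (sigma k)^-1%:E * pstar z')%E
              ((sigma k)^-1 *: x k - Astar (y k.+1))) &
      (forall k, x k.+1 = x k - sigma k *: (Astar (y k.+1) + z k.+1))].

Definition criterionA (R : realType) (n m : nat)
    (Astar : 'cV[R]_m -> 'cV[R]_n) (b : 'cV[R]_m)
    (pstar : 'cV[R]_n -> \bar R) (eps sigma : nat -> R)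
    (y : nat -> 'cV[R]_m) (x : nat -> 'cV[R]_n) : Prop :=
  forall k, enorm (grad (psi Astar b pstar (sigma k) (x k)) (y k.+1))
            <= eps k / Num.sqrt (sigma k).

Definition criterionB (R : realType) (n m : nat)
    (Astar : 'cV[R]_m -> 'cV[R]_n) (b : 'cV[R]_m)
    (pstar : 'cV[R]_n -> \bar R) (delta sigma : nat -> R)
    (y : nat -> 'cV[R]_m) (x : nat -> 'cV[R]_n) : Prop :=
  forall k, enorm (grad (psi Astar b pstar (sigma k) (x k)) (y k.+1))
            <= delta k / Num.sqrt (sigma k) * enorm (x k.+1 - x k).

Definition kktmap (R : realType) (n : nat) (f p : 'cV[R]_n -> R)
    (x : 'cV[R]_n) : set 'cV[R]_n :=
  [set grad f x + v | v in subdiff p x].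

Definition error_bound (R : realType) (n : nat) (f p : 'cV[R]_n -> R)
    (Omega : set 'cV[R]_n) (r kappa : R) : Prop :=
  forall x, dist x Omega <= r -> dist x Omega <= kappa * dist 0 (kktmap f p x).

Definition mu (R : realType) (kappa delta sigma : R) : R :=
  (delta + (1 + delta) * kappa / Num.sqrt (kappa ^+ 2 + sigma ^+ 2))
  / (1 - delta).

Definition mu' (R : realType) (delta sigma : R) : R :=
  1 / ((1 - delta) * sigma).

Definition mu'' (R : realType) (n : nat) (delta sigma : R)
    (x xnext : 'cV[R]_n) : R :=
  (delta ^+ 2 * enorm (xnext - x) + enorm xnext + enorm x)
  / (2 * (1 - delta) * sigma).

(* Main.v *)
Require Import Defs.
From mathcomp Require Import all_boot all_order all_algebra.
From mathcomp Require Import all_classical all_reals all_analysis.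
From mathcomp Require Import ring lra.

Set Implicit Arguments.
Unset Strict Implicit.
Unset Printing Implicit Defensive.

Import Order.TTheory GRing.Theory Num.Theory.
Import numFieldNormedType.Exports.

Local Open Scope classical_set_scope.
Local Open Scope ring_scope.

(** The regularizer is a coercive gauge: sublinear, continuous, and at least a
    positive multiple of the norm. The conjugate of a gauge [p] is therefore
    the indicator function of its polar set, the set of [z] such that
    [dot z u <= p u] for all [u]; and [z] is a subgradient of [p] at [x] exactly
    when [z] is in the polar set and [dot z x = p x] ([subdiff_gaugeP]).
    Minimizing [p] plus a quadratic centred at [w] gives Moreau's decomposition
    [w = x' + sigma *: z] with [z] a subgradient at [x'] ([moreau]). Here [z] is
    the projection of [sigma^-1 *: w] on the polar set, which evaluates both the
    prox in the algorithm and the infimum in [psi] ([Prox_conjugate],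
    [psi_moreau]).

    For [w = x k - sigma k *: Astar (y k.+1)] the two parts are [x k.+1] and
    [z k.+1], and the gradient of [psi] at [y k.+1] is the vector [e] such that
    [y k.+1 = A (x k.+1) - b + e] ([grad_psi]). An iteration is thus a proximal
    point step of length [sigma k] on the primal problem in which the dual
    variable is off by [e] ([resolvent_step]). All estimates come from comparing
    two steps of the same length: monotonicity of the subdifferential, and a
    completed square in the image under [A], make the step firmly nonexpansive
    up to [sigma / 4 * enorm (e1 - e2) ^+ 2] ([resolvent_step_compare]).

    Comparison with the constant step at a primal solution gives quasi-Fejer
    monotonicity. The increments of [x] then vanish and the objective values
    tend to the minimum, so a cluster point is a solution, and quasi-Fejer
    monotonicity with respect to that solution makes the whole sequence converge
    to it ([ialm_primal_cvg]). The dual iterates are expressed by consecutive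
    primal ones and vanishing errors, and strong concavity in [y] makes their
    limit the only dual solution ([ialm_dual_cvg], [dual_opt_unique]).

    For the rates, comparison with the exact step from the same point bounds the
    distance to the proximal point by [delta * enorm (x' - x)]. The exact step
    contracts the distance to the solution set, because the error bound applies
    to the proximal point, whose residual is the increment divided by [sigma]
    ([step_exact_contraction]); the triangle inequality transfers this to the
    inexact step. The gap of the dual objective is bounded by completing the
    square in the dual objective around [y k.+1] ([resolvent_step_dual_gap]). *)

(** * Euclidean geometry *)

Section InnerProduct.
Context {R : realType} {n : nat}.
Implicit Types (u v w x : 'cV[R]_n) (a : R).

Lemma dotC u v : dot u v = dot v u.
Proof. by apply: eq_bigr => i _; rewrite mulrC. Qed.

Lemma dotDl u v w : dot (u + v) w = dot u w + dot v w.
Proof. by rewrite -big_split; apply: eq_bigr => i _; rewrite mxE mulrDl. Qed.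

Lemma dotZl a u v : dot (a *: u) v = a * dot u v.
Proof. by rewrite mulr_sumr; apply: eq_bigr => i _; rewrite mxE mulrA. Qed.

Lemma dotNl u v : dot (- u) v = - dot u v.
Proof. by rewrite -scaleN1r dotZl mulN1r. Qed.

Lemma dotDr u v w : dot u (v + w) = dot u v + dot u w.
Proof. by rewrite !(dotC u) dotDl. Qed.

Lemma dotZr a u v : dot u (a *: v) = a * dot u v.
Proof. by rewrite !(dotC u) dotZl. Qed.

Lemma dotNr u v : dot u (- v) = - dot u v.
Proof. by rewrite !(dotC u) dotNl. Qed.

Lemma dot0l v : dot 0 v = 0.
Proof. by rewrite -(scale0r 0) dotZl mul0r. Qed.

Definition dotE := (dotDl, dotDr, dotNl, dotNr, dotZl, dotZr).

Lemma dot_delta u i : dot u (delta_mx i 0) = u i 0.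
Proof.
rewrite /dot (bigD1 i)//= mxE !eqxx mulr1 big1 ?addr0// => j ji.
by rewrite mxE (negbTE ji) mulr0.
Qed.

Lemma dot_inj u v : (forall w, dot u w = dot v w) -> u = v.
Proof.
by move=> uv; apply/colP => i; rewrite -!dot_delta uv.
Qed.

Lemma dot_ge0 u : 0 <= dot u u.
Proof. by apply: sumr_ge0 => i _; rewrite -expr2 sqr_ge0. Qed.

Lemma enorm_ge0 u : 0 <= enorm u.
Proof. exact: sqrtr_ge0. Qed.

Lemma enorm_sqr u : enorm u ^+ 2 = dot u u.
Proof. by rewrite sqr_sqrtr ?dot_ge0. Qed.

Lemma enormZ a u : enorm (a *: u) = `|a| * enorm u.
Proof. by rewrite /enorm dotZl dotZr mulrA sqrtrM ?sqr_ge0// -expr2 sqrtr_sqr. Qed.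

Lemma enormN u : enorm (- u) = enorm u.
Proof. by rewrite -scaleN1r enormZ normrN1 mul1r. Qed.

Lemma enorm0 : enorm (0 : 'cV[R]_n) = 0.
Proof. by rewrite /enorm dot0l sqrtr0. Qed.

Lemma enormB u v : enorm (u - v) = enorm (v - u).
Proof. by rewrite -enormN opprB. Qed.

Lemma coord_le_enorm u i : `|u i 0| <= enorm u.
Proof.
rewrite -sqrtr_sqr; apply: ler_wsqrtr.
rewrite /dot (bigD1 i)//= expr2 lerDl; apply: sumr_ge0 => j _.
by rewrite -expr2 sqr_ge0.
Qed.

Lemma enorm_eq0 u : enorm u = 0 -> u = 0.
Proof.
move=> u0; apply/colP => i; rewrite mxE; apply/eqP.
by rewrite -normr_eq0 eq_le normr_ge0 andbT -u0 coord_le_enorm.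
Qed.

Lemma enorm_le_norm1 u : enorm u <= norm1 u.
Proof.
rewrite -(@ler_pXn2r _ 2)// ?nnegrE ?enorm_ge0 ?sumr_ge0// enorm_sqr.
rewrite expr2 /norm1 mulr_suml; apply: ler_sum => i _.
rewrite (le_trans (ler_norm _))// normrM ler_wpM2l//.
by rewrite (bigD1 i)//= lerDl sumr_ge0.
Qed.

Lemma cauchy_schwarz u v : dot u v <= enorm u * enorm v.
Proof.
have [|v0] := eqVneq (enorm v) 0.
  by move=> /enorm_eq0->; rewrite dotC dot0l enorm0 mulr0.
have vp : 0 < enorm v by rewrite lt_neqAle eq_sym v0 enorm_ge0.
have := dot_ge0 (enorm v *: u - enorm u *: v).
rewrite !dotE (dotC v u) -!enorm_sqr => h.
have [|u0] := eqVneq (enorm u) 0.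
  by move=> /enorm_eq0->; rewrite dot0l enorm0 mul0r.
have up : 0 < enorm u by rewrite lt_neqAle eq_sym u0 enorm_ge0.
rewrite -subr_ge0 -(pmulr_rge0 _ (mulr_gt0 up vp)); nra.
Qed.

Lemma ler_enormD u v : enorm (u + v) <= enorm u + enorm v.
Proof.
rewrite -(@ler_pXn2r _ 2)// ?nnegrE ?addr_ge0 ?enorm_ge0//.
rewrite sqrrD !enorm_sqr !dotE (dotC v u).
have := cauchy_schwarz u v; lra.
Qed.

Lemma ler_enorm_dist u v w : enorm (u - w) <= enorm (u - v) + enorm (v - w).
Proof. by rewrite (le_trans _ (ler_enormD _ _))// subrKA. Qed.

End InnerProduct.

Section Topology.
Context {R : realType} {n : nat}.
Implicit Types (u v : 'cV[R]_n).

Lemma sum_continuous (T : topologicalType) (I : Type) (r : seq I)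
    (F : I -> T -> R) :
  (forall i, continuous (F i)) -> continuous (fun x => \sum_(i <- r) F i x).
Proof.
move=> cF x; elim: r => [|i r ih].
  rewrite (_ : (fun y => _) = cst 0); first exact: cvg_cst.
  by apply/funext => y; rewrite big_nil.
rewrite (_ : (fun y => _) = fun y => F i y + \sum_(j <- r) F j y); last first.
  by apply/funext => y; rewrite big_cons.
by apply: cvgD => //; exact: cF.
Qed.

Lemma cvg_coord (T : Type) (F : set_system T) {FF : Filter F}
    (a : T -> 'cV[R]_n) u :
  (forall i, a t i 0 @[t --> F] --> u i 0) -> a @ F --> u.
Proof.
move=> cv.
have key (s : seq 'I_n) :
    (\sum_(i <- s) a t i 0 *: delta_mx i 0) @[t --> F] -->
    (\sum_(i <- s) u i 0 *: delta_mx i 0 : 'cV[R]_n).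
  elim: s => [|i s ih].
    rewrite (_ : (fun y => _) = cst 0); first by rewrite big_nil; exact: cvg_cst.
    by apply/funext => y; rewrite big_nil.
  rewrite (_ : (fun y => _) = fun t => a t i 0 *: delta_mx i 0 +
    \sum_(j <- s) a t j 0 *: delta_mx j 0); last first.
    by apply/funext => y; rewrite big_cons.
  by rewrite big_cons; apply: cvgD => //; apply: cvgZr_tmp.
have E v : v = \sum_(i < n) v i 0 *: delta_mx i 0.
  rewrite [LHS]matrix_sum_delta; apply: eq_bigr => i _.
  by rewrite big_ord1.
rewrite (E u) (_ : a = fun t => \sum_(i < n) a t i 0 *: delta_mx i 0).
  exact: key.
by apply/funext => t; exact: E.
Qed.

Lemma dot_continuous (T : topologicalType) (F G : T -> 'cV[R]_n) :
  continuous F -> continuous G -> continuous (fun t => dot (F t) (G t)).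
Proof.
move=> cF cG; apply: sum_continuous => i t.
pose c (v : 'cV[R]_n) := v i 0.
by apply: cvgM; [apply: (cvg_comp F c (cF t)) | apply: (cvg_comp G c (cG t))];
   exact: coord_continuous.
Qed.

Lemma enorm_continuous : continuous (@enorm R n).
Proof.
move=> x; apply: (cvg_comp (fun u => dot u u) Num.sqrt).
  by apply: (dot_continuous (F := id) (G := id)) => // y; exact: cvg_id.
exact: sqrt_continuous.
Qed.

Lemma enorm_sub_continuous v : continuous (fun u => enorm (u - v)).
Proof.
move=> u; apply: (cvg_comp (fun w => w - v) (@enorm R n)).
  by apply: (@continuousB _ _ _ id (cst v)); [exact: cvg_id|exact: cst_continuous].
exact: enorm_continuous.
Qed.

(** Links the Euclidean norm to the topology, which is defined by the maximum
    norm. *)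
Lemma cvg_enorm (a : nat -> 'cV[R]_n) u :
  enorm (a k - u) @[k --> \oo] --> 0 -> a @ \oo --> u.
Proof.
move=> /cvgr0Pnorm_lt au; apply: cvg_coord => i; apply/cvgrPdist_lt => e /au.
apply: filterS => k; apply: le_lt_trans.
rewrite [leRHS]ger0_norm ?enorm_ge0// enormB.
by have := coord_le_enorm (u - a k) i; rewrite !mxE.
Qed.

Lemma closed_ball_compact (r : R) : compact [set u : 'cV[R]_n | enorm u <= r].
Proof.
have K : compact [set v : 'rV[R]_n | forall i, `[- r, r]%classic (v ord0 i)].
  by apply: (@rV_compact _ _ (fun=> `[- r, r]%classic)) => _; exact: segment_compact.
have trc : continuous (@trmx R 1 n).
  move=> v; apply: (@cvg_coord _ (nbhs v) _ trmx) => i; rewrite mxE.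
  rewrite (_ : (fun w : 'rV_n => _) = fun w => w 0 i); last first.
    by apply/funext => w; rewrite mxE.
  exact: coord_continuous.
apply: (subclosed_compact _ (continuous_compact (continuous_subspaceT trc) K)).
  rewrite (_ : mkset _ = @enorm R n @^-1` [set t | t <= r])//.
  apply: closed_comp; last exact: closed_le.
  by move=> u _; exact: enorm_continuous.
move=> u /= ur; exists u^T; last exact: trmxK.
by move=> i; rewrite /= in_itv/= mxE -ler_norml (le_trans (coord_le_enorm _ _)).
Qed.

(** Compactness enters through this lemma and [bounded_cluster] only. *)
Lemma exists_min (S : set 'cV[R]_n) (F : 'cV[R]_n -> R) u (B : R) :
  closed S -> continuous F -> S u ->
  (forall v, S v -> F v <= F u -> enorm v <= B) ->
  exists2 v, S v & forall w, S w -> F v <= F w.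
Proof.
move=> clS cF Su bnd.
pose K := S `&` [set v : 'cV[R]_n | enorm v <= B].
have cK : compact K.
  by rewrite /K setIC; apply: compact_closedI => //; exact: closed_ball_compact.
have Ku : K u by split => //; exact: bnd.
have [||v Kv vmin] := compact_EVT_min _ cK (f := F).
- by exists u.
- exact: continuous_subspaceT.
move: Kv; rewrite inE => -[Sv _]; exists v => // w Sw.
have [wu|/ltW uw] := leP (F w) (F u).
  by apply: vmin; rewrite inE; split => //; exact: bnd.
by apply: le_trans uw; apply: vmin; rewrite inE.
Qed.

Lemma bounded_cluster (a : nat -> 'cV[R]_n) (B : R) :
  (forall k, enorm (a k) <= B) -> exists u, cluster (a @ \oo) u.
Proof.
move=> aB; have := @closed_ball_compact B (a @ \oo) _.
case; last by move=> u [_ ?]; exists u.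
by exists 0%N => // k _; exact: aB.
Qed.

(** A remainder that is quadratic along each line: weaker than
    differentiability, but enough for partial derivatives and for first-order
    optimality conditions. *)
Definition expands_at (F : 'cV[R]_n -> R) u v :=
  forall d, exists C, forall t,
    `|F (u + t *: d) - F u - t * dot v d| <= C * t ^+ 2.

Lemma grad_eq (F : 'cV[R]_n -> R) u v : expands_at F u v -> grad F u = v.
Proof.
move=> Fq; apply/colP => i; rewrite mxE; apply: cvg_lim => //.
have [C FC] := Fq (delta_mx i 0).
apply/cvgrPdist_lt => e e0; near=> h.
have h0 : h != 0 by near: h; exact: nbhs_dnbhs_neq.
rewrite distrC -(ltr_pM2r (_ : 0 < `|h|)) ?normr_gt0// -normrM mulrBl.
rewrite /= /shift/= -[_ *: _]/(h^-1 * _) mulrAC mulVf// mul1r addrC.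
rewrite (addrC (h *: _)) [_ + (_ - _)]addrC (mulrC _ h) -dot_delta.
apply: le_lt_trans (FC h) _.
rewrite -real_normK ?num_real// expr2 mulrA ltr_pM2r ?normr_gt0//.
apply: le_lt_trans (_ : (`|C| + 1) * `|h| < _).
  by rewrite ler_wpM2r// (le_trans (ler_norm _))// lerDl.
rewrite mulrC -ltr_pdivlMr ?ltr_wpDl//.
near: h; apply: dnbhs0_lt; rewrite divr_gt0// ltr_wpDl//.
Unshelve. all: by end_near. Qed.

End Topology.

Section Sequences.
Context {R : realType}.
Implicit Types (u eps : nat -> R).

Lemma series_le_lim eps k : (forall k, 0 <= eps k) -> cvgn (series eps) ->
  series eps k <= limn (series eps).
Proof.
move=> e0 ce; apply: nondecreasing_cvgn_le => //.
by apply: nondecreasing_series => i _ _.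
Qed.

Lemma quasi_decreasing_le u eps k :
  (forall k, u k.+1 <= u k + eps k) -> u k <= u 0%N + series eps k.
Proof.
move=> ue; elim: k => [|k ih]; first by rewrite /series/= big_geq// addr0.
by rewrite (le_trans (ue k))// seriesEnat/= big_nat_recr//= addrA lerD2r.
Qed.

(** Subtracting the partial sums of [eps] leaves a nonincreasing sequence that
    is bounded below by the opposite of the sum of [eps]. *)
Lemma quasi_decreasing_is_cvgn u eps :
  (forall k, 0 <= u k) -> (forall k, 0 <= eps k) -> cvgn (series eps) ->
  (forall k, u k.+1 <= u k + eps k) -> cvgn u.
Proof.
move=> u0 e0 ce ue.
have -> : u = (u - series eps) + series eps by rewrite subrK.
apply: is_cvgD => //; apply: nonincreasing_is_cvgn.
  apply/nonincreasing_seqP => k; have := ue k.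
  rewrite !fctE seriesEnat/= big_nat_recr//=; lra.
exists (- limn (series eps)) => _ [k _ <-].
rewrite !fctE (le_trans (_ : _ <= - series eps k))//.
  by rewrite lerN2 series_le_lim.
by rewrite lerDr.
Qed.

End Sequences.

Lemma cvg_sqr (R : realType) (u : nat -> R) (l : R) :
  u @ \oo --> l -> u k ^+ 2 @[k --> \oo] --> l ^+ 2.
Proof. by move=> ul; exact: (cvgM ul ul). Qed.

Lemma cvg_sqr0 (R : realType) (u : nat -> R) : (forall k, 0 <= u k) ->
  u k ^+ 2 @[k --> \oo] --> 0 -> u @ \oo --> 0.
Proof.
move=> u0 cu; rewrite -(sqrtr0 R) (_ : u = Num.sqrt \o (fun k => u k ^+ 2)).
  by apply: (cvg_comp _ Num.sqrt cu); exact: sqrt_continuous.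
by apply/funext => k; rewrite /= sqrtr_sqr ger0_norm.
Qed.

Lemma cluster_lim (R : realType) (n : nat) (F : 'cV[R]_n -> R)
    (a : nat -> 'cV[R]_n) u (l : R) :
  continuous F -> cluster (a @ \oo) u -> F (a k) @[k --> \oo] --> l -> F u = l.
Proof.
move=> cF au Fl; apply/eqP; rewrite -subr_eq0 -normr_le0.
apply/ler_addgt0Pl => d d0; rewrite addr0.
have d2 : 0 < d / 2 by rewrite divr_gt0.
have near_l : (a @ \oo) [set v | `|l - F v| < d / 2].
  by move/cvgrPdist_lt : Fl => /(_ _ d2).
have near_u : nbhs u [set v | `|F u - F v| < d / 2].
  by move/cvgrPdist_lt : (cF u) => /(_ _ d2).
have [v [/= lv uv]] := au _ _ near_l near_u.
rewrite (_ : F u - l = (F u - F v) - (l - F v)); last by ring.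
by apply: le_trans (ler_normB _ _) _; lra.
Qed.

Section Dist.
Context {R : realType} {n : nat}.
Implicit Types (u v x : 'cV[R]_n) (Omega : set 'cV[R]_n).

Lemma dist_le x Omega v : Omega v -> dist x Omega <= enorm (x - v).
Proof.
move=> Ov; apply: ge_inf; last by exists v.
by exists 0 => _ [u _ <-]; exact: enorm_ge0.
Qed.

Lemma dist_attained x Omega : closed Omega -> Omega !=set0 ->
  exists2 v, Omega v & dist x Omega = enorm (x - v).
Proof.
move=> clO [u Ou].
have [|v Ov vmin] := exists_min clO (@enorm_sub_continuous _ _ x) Ou
    (B := enorm (u - x) + enorm x).
  move=> v _ vu; rewrite -[v](subrK x); apply: le_trans (ler_enormD _ _) _.
  by rewrite lerD2r; exact: vu.
exists v => //; apply/eqP; rewrite eq_le dist_le//=.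
apply: lb_le_inf; first by exists (enorm (x - u)), u.
by move=> _ [w Ow <-]; rewrite !(enormB x); exact: vmin.
Qed.

End Dist.

(** * Gauges, polar sets and Moreau's decomposition *)

Definition coercive_gauge (R : realType) (n : nat) (p : 'cV[R]_n -> R) :=
  [/\ forall u v, p (u + v) <= p u + p v,
      forall t u, 0 <= t -> p (t *: u) = t * p u,
      continuous p &
      exists2 M : R, 0 < M & forall u, enorm u <= M * p u].

Definition polar (R : realType) (n : nat) (p : 'cV[R]_n -> R) : set 'cV[R]_n :=
  [set z | forall u, dot z u <= p u].

(** Stands for a limit [t --> 0] in the derivation of optimality conditions. *)
Lemma ge0_from_linear_perturbation (R : realType) (a C : R) :
  (forall t, 0 < t <= 1 -> 0 <= a + C * t) -> 0 <= a.
Proof.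
move=> aC; rewrite leNgt; apply/negP => a0.
have C1 : 0 < `|C| + 1 by rewrite ltr_wpDl.
(* Small enough for [C * t] to stay below half of [- a]. *)
pose t := Num.min 1 (- a / (2 * (`|C| + 1))).
have t0 : 0 < t.
  by rewrite lt_min ltr01 divr_gt0 ?mulr_gt0 ?oppr_gt0.
have t1 : t <= 1 by rewrite ge_min lexx.
have := aC t; rewrite t0 t1 => /(_ isT).
have : t <= - a / (2 * (`|C| + 1)) by rewrite ge_min lexx orbT.
rewrite ler_pdivlMr ?mulr_gt0// => h1 h2.
have := ler_norm C; nra.
Qed.

Section Gauge.
Context {R : realType} {n : nat} (p : 'cV[R]_n -> R).
Hypothesis p_gauge : coercive_gauge p.
Implicit Types (u v w x z : 'cV[R]_n).

Let p_sub u v : p (u + v) <= p u + p v. Proof. by case: p_gauge. Qed.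
Let p_hom t u : 0 <= t -> p (t *: u) = t * p u.
Proof. by case: p_gauge => _ + _ _; exact. Qed.

Lemma gauge0 : p 0 = 0.
Proof. by rewrite -(scale0r 0) p_hom// mul0r. Qed.

Lemma gauge_segment u v t : 0 <= t <= 1 ->
  p (u + t *: (v - u)) <= p u + t * (p v - p u).
Proof.
move=> /andP[t0 t1].
rewrite (_ : u + _ = (1 - t) *: u + t *: v); last first.
  by apply/colP => i; rewrite !mxE; ring.
apply: le_trans (p_sub _ _) _; rewrite !p_hom ?subr_ge0//.
by rewrite [leLHS](_ : _ = p u + t * (p v - p u))//; ring.
Qed.

(** The subgradient inequality at [x + u] combines with sublinearity, and the
    one at [0] gives the reverse bound in the equality. *)
Lemma subdiff_gaugeP x z : subdiff p x z <-> polar p z /\ dot z x = p x.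
Proof.
split => [zx|[zp zx] x']; last first.
  by rewrite !dotE zx; have := zp x'; lra.
have zp : polar p z.
  move=> u; have := zx (x + u); rewrite (addrC x u) addrK => h.
  by have := p_sub u x; lra.
split => //; apply/eqP; rewrite eq_le zp/=.
by have := zx 0; rewrite gauge0 sub0r dotNr; lra.
Qed.

Lemma subdiff_monotone x z x' z' : subdiff p x z -> subdiff p x' z' ->
  0 <= dot (z - z') (x - x').
Proof.
move=> h h'; have := h x'; have := h' x.
by rewrite !dotE; lra.
Qed.

Lemma conjugate_polar z : polar p z -> conjugate p z = 0%E.
Proof.
move=> zp; apply/eqP; rewrite eq_le; apply/andP; split.
  by apply: ge_ereal_sup => _ [u _ <-]; rewrite lee_fin dotC subr_le0.
apply: ereal_sup_ubound; exists 0 => //.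
by rewrite dot0l gauge0 subrr.
Qed.

(** If [dot z u] exceeds [p u] for some [u], the excess is scaled without bound
    along the ray of [u]. *)
Lemma conjugate_notin_polar z : ~ polar p z -> conjugate p z = +oo%E.
Proof.
move=> /existsNP[u /negP]; rewrite -ltNge -subr_gt0 => zu.
apply/eqyP => a a0; pose t := a / (dot z u - p u).
have t0 : 0 < t by rewrite divr_gt0.
apply: ereal_sup_ge; exists (dot (t *: u) z - p (t *: u))%:E.
  by exists (t *: u).
rewrite p_hom ?(ltW t0)// dotZl -mulrBr (dotC u) /t divfK ?lexx//.
by rewrite gt_eqF.
Qed.

(** Pythagoras' inequality for the projection onto the polar set: [x] is an
    outward normal of this set at [z]. *)
Lemma polar_obtuse x z z' a : 0 <= a -> subdiff p x z -> polar p z' ->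
  enorm (a *: x) ^+ 2 + enorm (z' - z) ^+ 2 <= enorm (z' - (z + a *: x)) ^+ 2.
Proof.
move=> a0 /subdiff_gaugeP[zp zx] /(_ x) z'x.
rewrite !enorm_sqr !dotE (dotC z z') (dotC x z) (dotC x z') zx; nra.
Qed.

Lemma exists_gauge_min (q : 'cV[R]_n -> R) :
  continuous q -> (forall u, 0 <= q u) ->
  exists x, forall u, q x + p x <= q u + p u.
Proof.
case: p_gauge => _ _ cp [M M0 pM] cq q0.
have cF : continuous (fun u => q u + p u).
  by move=> u; exact: (continuousD (cq u) (cp u)).
have [|x _ xmin] := exists_min closedT cF I (u := 0) (B := M * (q 0 + p 0)).
  move=> v _ vle; apply: le_trans (pM v) _; rewrite (ler_wpM2l (ltW M0))//.
  by apply: le_trans _ vle; rewrite lerDr.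
by exists x => u; exact: xmin.
Qed.

(** First-order optimality: along the segment to any other point, convexity
    bounds the increase of [p] linearly, and the increase of [q] is linear up to
    a quadratic term. *)
Lemma gauge_min_subdiff (q : 'cV[R]_n -> R) x v :
  expands_at q x v -> (forall u, q x + p x <= q u + p u) ->
  subdiff p x (- v).
Proof.
move=> qv xmin x'; have [C qC] := qv (x' - x).
suff : 0 <= dot v (x' - x) + p x' - p x by rewrite dotNl; lra.
apply: (@ge0_from_linear_perturbation _ _ C) => t /andP[t0 t1].
have t01 : 0 <= t <= 1 by rewrite ltW.
have := gauge_segment x x' t01.
have := xmin (x + t *: (x' - x)).
have := qC t; rewrite ler_norml => /andP[_ h1] h2 h3.
rewrite -(pmulr_rge0 _ t0); nra.
Qed.

Lemma prox_term_expands (c : R) w x :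
  expands_at (fun u => c / 2 * enorm (u - w) ^+ 2) x (c *: (x - w)).
Proof.
move=> d; exists `|c / 2 * dot d d| => t.
rewrite !enorm_sqr (_ : _ - _ = c / 2 * dot d d * t ^+ 2).
  by rewrite normrM [`|t ^+ 2|]ger0_norm ?sqr_ge0.
by rewrite !dotE (dotC x d) (dotC w d) (dotC w x); field.
Qed.

Lemma prox_term_continuous (c : R) w :
  continuous (fun u => c / 2 * enorm (u - w) ^+ 2).
Proof.
move=> u; have cE := enorm_sub_continuous (v := w) (x := u).
exact: (continuousM (@cst_continuous _ _ (c / 2) u) (continuousM cE cE)).
Qed.

(** Moreau's decomposition of [w] along the prox of [sigma *: p] and the
    projection onto the polar set. Obtaining the latter from the former avoids
    the separation theorem that would show [p] to be the support function of
    its polar set. *)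
Lemma moreau (sigma : R) w : 0 < sigma ->
  exists x z, subdiff p x z /\ w = x + sigma *: z.
Proof.
move=> s0.
have [|x xmin] := exists_gauge_min (@prox_term_continuous (sigma^-1) w).
  by move=> u; rewrite mulr_ge0 ?sqr_ge0// divr_ge0// invr_ge0 ltW.
exists x, (- (sigma^-1 *: (x - w))); split.
  exact: gauge_min_subdiff (prox_term_expands _ _ _) xmin.
by rewrite scalerN scalerA divff ?gt_eqF// scale1r opprB addrC subrK.
Qed.

(** The function that is minimized is, up to the factor 1/2, the squared
    distance restricted to the polar set: [polar_obtuse] identifies its only
    minimizer. *)
Lemma Prox_conjugate (sigma : R) x z : 0 < sigma -> subdiff p x z ->
  Prox (fun z' => sigma^-1%:E * conjugate p z')%E (z + sigma^-1 *: x) = z.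
Proof.
move=> s0 zx; have [zp _] := (subdiff_gaugeP _ _).1 zx.
have si0 : 0 < sigma^-1 by rewrite invr_gt0.
have val z' : polar p z' -> (sigma^-1%:E * conjugate p z' +
    (2^-1 * enorm (z' - (z + sigma^-1 *: x)) ^+ 2)%:E)%E =
    (2^-1 * enorm (z' - (z + sigma^-1 *: x)) ^+ 2)%:E.
  by move=> /conjugate_polar->; rewrite mule0 add0e.
have valy z' : ~ polar p z' -> (sigma^-1%:E * conjugate p z' +
    (2^-1 * enorm (z' - (z + sigma^-1 *: x)) ^+ 2)%:E)%E = +oo%E.
  by move=> /conjugate_notin_polar->; rewrite gt0_muley ?lte_fin.
have zval : enorm (z - (z + sigma^-1 *: x)) = enorm (sigma^-1 *: x).
  by rewrite opprD addrA subrr sub0r enormN.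
apply: xget_unique => /=.
  move=> z'; rewrite (val z)// zval.
  have [z'p|/valy->] := pselect (polar p z'); last exact: leey.
  rewrite val// lee_fin ler_pM2l ?invr_gt0//.
  by apply: le_trans (polar_obtuse (ltW si0) zx z'p); rewrite lerDl sqr_ge0.
move=> z' /(_ z); rewrite (val z)// zval.
have [z'p|/valy->] := pselect (polar p z'); last by [].
rewrite val// lee_fin ler_pM2l ?invr_gt0// => h.
have := polar_obtuse (ltW si0) zx z'p => h'.
have : enorm (z' - z) ^+ 2 <= 0 by lra.
rewrite real_exprn_even_le0//= ?num_real// => /eqP/enorm_eq0/eqP.
by rewrite subr_eq0 => /eqP.
Qed.

End Gauge.

(** * The group lasso regularizer *)

Section GroupLasso.
Context {R : realType} {n g : nat}.
Implicit Types (u v : 'cV[R]_n) (B : {set 'I_n}).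

Lemma restrD u v B : restr (u + v) B = restr u B + restr v B.
Proof. by apply/colP => i; rewrite !mxE. Qed.

Lemma restrZ t u B : restr (t *: u) B = t *: restr u B.
Proof. by apply/colP => i; rewrite !mxE. Qed.

Lemma restr_continuous B : continuous (fun u => restr u B).
Proof.
move=> u; apply: (@cvg_coord _ _ _ (nbhs u) _ (fun u => restr u B)) => i.
rewrite mxE (_ : (fun v : 'cV_n => _) = fun v => v (enum_val i) 0).
  exact: coord_continuous.
by apply/funext => v; rewrite mxE.
Qed.

Lemma coord_le_restr u B i : i \in B -> `|u i 0| <= enorm (restr u B).
Proof.
move=> iB; have := coord_le_enorm (restr u B) (enum_rank_in iB i).
by rewrite mxE enum_rankK_in.
Qed.

(** Coercivity: every coordinate lies in a group, so it is controlled by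
    [lambda1] through the 1-norm and by [lambda2] through the norm of its group,
    and one of the two weights is positive. *)
Lemma reg_coercive_gauge (lambda1 lambda2 : R) (G : 'I_g -> {set 'I_n})
    (w : 'I_g -> R) :
  0 <= lambda1 -> 0 <= lambda2 -> 0 < lambda1 + lambda2 ->
  finset.partition [set G l | l : 'I_g]%SET [set: 'I_n]%SET ->
  (forall l, 0 < w l) ->
  coercive_gauge (reg lambda1 lambda2 G w).
Proof.
move=> l1 l2 l12 Gpart w0; split.
- move=> u v; rewrite /reg addrACA -!mulrDr -!big_split/=.
  rewrite lerD// ler_wpM2l// ler_sum// => i _.
    by rewrite mxE ler_normD.
  by rewrite -mulrDr ler_wpM2l ?(ltW (w0 _))// restrD ler_enormD.
- move=> t u t0; rewrite /reg mulrDr; congr (_ + _); rewrite mulrCA; congr (_ * _).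
    by rewrite /norm1 mulr_sumr; apply: eq_bigr => i _; rewrite mxE normrM ger0_norm.
  rewrite mulr_sumr; apply: eq_bigr => l _; by rewrite restrZ enormZ ger0_norm// mulrCA.
- have c1 : continuous (@norm1 R n).
    apply: sum_continuous => i u.
    apply: (cvg_comp (fun v : 'cV_n => v i 0) (fun t : R => `|t|)).
      exact: coord_continuous.
    exact: norm_continuous.
  have c2 : continuous (fun u => \sum_(l < g) w l * enorm (restr u (G l))).
    apply: sum_continuous => l u.
    have cl : {for u, continuous (fun v => enorm (restr v (G l)))}.
      apply: (cvg_comp (fun v => restr v (G l)) (@enorm R _)).
        exact: restr_continuous.
      exact: enorm_continuous.
    exact: (continuousM (@cst_continuous _ _ (w l) u) cl).
  move=> u; exact: (continuousD
    (continuousM (@cst_continuous _ _ lambda1 u) (c1 u))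
    (continuousM (@cst_continuous _ _ lambda2 u) (c2 u))).
have /choice[gr grP] : forall i, exists l, i \in G l.
  move=> i; have : i \in finset.cover [set G l | l : 'I_g]%SET.
    by rewrite (finset.cover_partition Gpart) finset.inE.
  move=> /finset.bigcupP[B /finset.imsetP[l _ ->] iB]; by exists l.
pose c i := lambda1 + lambda2 * w (gr i).
have c0 i : 0 < c i.
  rewrite /c; have [l10|l10] := eqVneq lambda1 0.
    by move: l12; rewrite l10 !add0r => l20; rewrite mulr_gt0.
  by rewrite ltr_wpDr ?mulr_ge0 ?(ltW (w0 _))// lt_neqAle eq_sym l10.
have p0 u : 0 <= reg lambda1 lambda2 G w u.
  rewrite addr_ge0// mulr_ge0// sumr_ge0// => l _.
  by rewrite mulr_ge0 ?enorm_ge0// ltW.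
have pc u i : c i * `|u i 0| <= reg lambda1 lambda2 G w u.
  rewrite mulrDl lerD// -?mulrA ler_wpM2l//.
    by rewrite /norm1 (bigD1 i)//= lerDl sumr_ge0.
  rewrite (bigD1 (gr i))//=.
  apply: (@le_trans _ _ (w (gr i) * enorm (restr u (G (gr i))))).
    by rewrite (ler_wpM2l (ltW (w0 _)))// coord_le_restr.
  by rewrite lerDl sumr_ge0// => l _; rewrite mulr_ge0 ?enorm_ge0// ltW.
exists (\sum_(i < n) (c i)^-1 + 1).
  by rewrite ltr_wpDl// sumr_ge0// => i _; rewrite invr_ge0 ltW.
move=> u; apply: le_trans (enorm_le_norm1 u) _.
rewrite mulrDl mul1r ler_wpDr// mulr_suml ler_sum// => i _.
by rewrite -ler_pdivrMl ?invr_gt0// invrK.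
Qed.

End GroupLasso.

(** * Least squares and the inner objective *)

Section Adjoint.
Context {R : realType} {n m : nat}.

(** The coordinates of [A x] are inner products with fixed vectors. *)
Lemma adjoint_continuous (A : 'cV[R]_n -> 'cV[R]_m) Astar :
  is_adjoint A Astar -> continuous A.
Proof.
move=> adj x; apply: (@cvg_coord _ _ _ (nbhs x) _ A) => i.
rewrite -dot_delta adj.
rewrite (_ : (fun t => _) = fun t => dot t (Astar (delta_mx i 0))); last first.
  by apply/funext => t; rewrite -dot_delta adj.
have ci : continuous (@id 'cV[R]_n) by move=> u; exact: cvg_id.
exact: (dot_continuous ci (@cst_continuous _ _ _) (x := x)).
Qed.

Lemma adjoint_sym (A : 'cV[R]_n -> 'cV[R]_m) Astar :
  is_adjoint A Astar -> is_adjoint Astar A.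
Proof. by move=> adj y x; rewrite dotC -adj dotC. Qed.

Lemma adjoint_add (A : 'cV[R]_n -> 'cV[R]_m) Astar y y' :
  is_adjoint A Astar -> Astar (y + y') = Astar y + Astar y'.
Proof.
by move=> /adjoint_sym adj; apply: dot_inj => u; rewrite adj !dotE !adj.
Qed.

Lemma adjoint_scale (A : 'cV[R]_n -> 'cV[R]_m) Astar t y :
  is_adjoint A Astar -> Astar (t *: y) = t *: Astar y.
Proof.
by move=> /adjoint_sym adj; apply: dot_inj => u; rewrite adj !dotE !adj.
Qed.

End Adjoint.

Section LeastSquares.
Context {R : realType} {n m : nat}.
Variables (A : {linear 'cV[R]_n -> 'cV[R]_m}) (Astar : 'cV[R]_m -> 'cV[R]_n).
Variables (b : 'cV[R]_m) (p : 'cV[R]_n -> R).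
Hypothesis A_adj : is_adjoint A Astar.
Hypothesis p_gauge : coercive_gauge p.
Implicit Types (x z u : 'cV[R]_n) (y d : 'cV[R]_m).

Let h x := lsq A b x + p x.

Lemma lsq_ge0 x : 0 <= lsq A b x.
Proof. by rewrite mulr_ge0 ?sqr_ge0// invr_ge0. Qed.

Lemma lsq_continuous : continuous (lsq A b).
Proof.
move=> x; apply: (cvg_comp A (fun v => 2^-1 * enorm (v - b) ^+ 2)).
  exact: adjoint_continuous A_adj x.
by have := @prox_term_continuous _ _ 1 b (A x); rewrite mul1r.
Qed.

Lemma lsq_expand x u :
  lsq A b (x + u) = lsq A b x + dot (A x - b) (A u) + dot (A u) (A u) / 2.
Proof.
rewrite /lsq !enorm_sqr linearD !dotE (dotC (A u)) (dotC b).
by rewrite (dotC (A u) b); field.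
Qed.

Lemma lsq_expands x : expands_at (lsq A b) x (Astar (A x - b)).
Proof.
move=> d; exists (dot (A d) (A d) / 2) => t.
rewrite lsq_expand linearZ !dotE (dotC _ d) -A_adj !dotE (dotC b).
rewrite [X in `|X|](_ : _ = dot (A d) (A d) / 2 * t ^+ 2).
  by rewrite ger0_norm// mulr_ge0 ?sqr_ge0// divr_ge0 ?dot_ge0.
rewrite (dotC (A d) b) (dotC (A d) (A x)); ring.
Qed.

Lemma grad_lsq x : grad (lsq A b) x = Astar (A x - b).
Proof. exact: grad_eq (lsq_expands x). Qed.

Lemma primal_opt_subdiff x : primal_opt h x -> subdiff p x (- Astar (A x - b)).
Proof.
move=> xopt; apply: (gauge_min_subdiff p_gauge (lsq_expands x)) => u.
by have := xopt u; rewrite /= lee_fin.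
Qed.

Lemma primal_opt_exists : exists x, primal_opt h x.
Proof.
have [x xmin] := exists_gauge_min p_gauge lsq_continuous lsq_ge0.
by exists x => u; rewrite /= lee_fin; exact: xmin.
Qed.

(** The relation between [x] and the next iterate [x'] for a step of length
    [sigma] whose dual variable [A x' - b + e] misses the exact one by [e]: for
    [e = 0], [x'] is the proximal point of [sigma *: h] at [x]. *)
Definition resolvent_step sigma x (e : 'cV[R]_m) x' z :=
  subdiff p x' z /\ x - x' = sigma *: (Astar (A x' - b + e) + z).

(** Two steps of the same length are compared by monotonicity of the
    subdifferential; the term [A (x1' - x2')] that strong convexity of the dual
    problem provides absorbs the error [e1 - e2] by completing the square. *)
Lemma resolvent_step_compare sigma x1 e1 x1' z1 x2 e2 x2' z2 : 0 < sigma ->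
  resolvent_step sigma x1 e1 x1' z1 -> resolvent_step sigma x2 e2 x2' z2 ->
  - (sigma / 4 * enorm (e1 - e2) ^+ 2) <=
    dot (x1 - x1' - (x2 - x2')) (x1' - x2').
Proof.
move=> s0 [zx1 ->] [zx2 ->].
have mono := subdiff_monotone zx1 zx2.
set D := x1' - x2' in mono *.
rewrite -scalerBr dotZl.
have -> : Astar (A x1' - b + e1) + z1 - (Astar (A x2' - b + e2) + z2) =
    Astar (A D + (e1 - e2)) + (z1 - z2).
  have -> : A x1' - b + e1 = A D + (e1 - e2) + (A x2' - b + e2).
    by rewrite linearB; apply/colP => i; rewrite !mxE; ring.
  by rewrite (adjoint_add _ _ A_adj); apply/colP => i; rewrite !mxE; ring.
rewrite (dotDl (Astar _)) (dotC (Astar _)) -A_adj dotDr enorm_sqr.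
move: (e1 - e2) (z1 - z2) D (A D) mono => e v D AD mono.
have := dot_ge0 (AD + 2^-1 *: e).
rewrite !dotE (dotC e) => sq; rewrite -subr_ge0.
by rewrite [leRHS](_ : _ = sigma * (dot AD AD + dot AD e + dot e e / 4 + dot v D));
  [rewrite pmulr_rge0//; lra | field].
Qed.

(** The optimality condition for the minimizer of the objective plus a
    quadratic centred at [x]. *)
Lemma resolvent_step_exists sigma x : 0 < sigma ->
  exists x' z, resolvent_step sigma x 0 x' z.
Proof.
move=> s0; pose q u := lsq A b u + sigma^-1 / 2 * enorm (u - x) ^+ 2.
have cq : continuous q.
  move=> u.
  exact: (continuousD (@lsq_continuous u) (@prox_term_continuous _ _ _ _ u)).
have q0 u : 0 <= q u.
  by rewrite addr_ge0 ?lsq_ge0// mulr_ge0 ?sqr_ge0// divr_ge0// invr_ge0 ltW.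
have [x' xmin] := exists_gauge_min p_gauge cq q0.
exists x', (- (Astar (A x' - b) + sigma^-1 *: (x' - x))); split.
  apply: (gauge_min_subdiff p_gauge _ xmin) => d.
  have [C1 h1] := lsq_expands x' d; have [C2 h2] := prox_term_expands sigma^-1 x x' d.
  exists (C1 + C2) => t; rewrite mulrDl.
  apply: le_trans (lerD (h1 t) (h2 t)); apply: le_trans (ler_normD _ _).
  rewrite le_eqVlt; apply/orP; left; apply/eqP; congr (`|_|).
  by rewrite dotDl /q; ring.
rewrite addr0 opprD addrA subrr sub0r scalerN scalerA divff ?gt_eqF//.
by rewrite scale1r opprB.
Qed.

Lemma resolvent_step_opt sigma x : primal_opt h x ->
  resolvent_step sigma x 0 x (- Astar (A x - b)).
Proof.
move=> /primal_opt_subdiff zx; split => //.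
by rewrite addr0 !subrr scaler0.
Qed.

Section Psi.
Variables (sigma : R) (x : 'cV[R]_n).
Hypothesis sigma_gt0 : 0 < sigma.

(** The infimum over [z] is a squared distance to the polar set, attained at
    the projection given by Moreau's decomposition. *)
Lemma psi_moreau y x' z :
  subdiff p x' z -> x - sigma *: Astar y = x' + sigma *: z ->
  psi Astar b (conjugate p) sigma x y =
    dot b y + 2^-1 * dot y y + (2 * sigma)^-1 * (dot x' x' - dot x x).
Proof.
move=> zx' w; have [zp _] := (subdiff_gaugeP p_gauge _ _).1 zx'.
have s0 := lt0r_neq0 sigma_gt0.
have res z' : Astar y + z' - sigma^-1 *: x = z' - (z + sigma^-1 *: x').
  have -> : x = x' + sigma *: z + sigma *: Astar y by rewrite -w subrK.
  rewrite !scalerDr !scalerA mulVf// !scale1r.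
  by apply/colP => i; rewrite !mxE; ring.
have zval : enorm (z - (z + sigma^-1 *: x')) = enorm (sigma^-1 *: x').
  by rewrite opprD addrA subrr sub0r enormN.
have val z' : polar p z' -> auglag Astar b (conjugate p) sigma y z' x =
    (dot b y + 2^-1 * enorm y ^+ 2 +
     (sigma / 2 * enorm (z' - (z + sigma^-1 *: x')) ^+ 2
      - (2 * sigma)^-1 * enorm x ^+ 2))%:E.
  by move=> /(conjugate_polar p_gauge) z'0; rewrite /auglag z'0 adde0 res.
rewrite /psi (_ : ereal_inf _ = auglag Astar b (conjugate p) sigma y z x).
  rewrite (val z)//= zval enormZ exprMn !enorm_sqr.
  rewrite real_normK ?num_real//; field; exact: s0.
apply/eqP; rewrite eq_le; apply/andP; split.
  by apply: ereal_inf_lbound; exists z.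
apply: le_ereal_inf_tmp => _ [z' _ <-].
have [z'p|/(conjugate_notin_polar p_gauge) z'p] := pselect (polar p z'); last first.
  by rewrite /auglag z'p addeC addeA addey ?leey.
rewrite (val z)// (val z')// lee_fin lerD2l lerD2r ler_pM2l ?divr_gt0//.
have si0 : 0 <= sigma^-1 by rewrite invr_ge0 ltW.
have := polar_obtuse p_gauge si0 zx' z'p.
by rewrite zval; have := sqr_ge0 (enorm (z' - z)); lra.
Qed.

(** Convexity of the squared norm bounds [psi] from below by its
    linearization, and the projection at [y] is a candidate in the infimum at
    [y + t *: d], which bounds it from above. *)
Lemma psi_expands y x' z :
  subdiff p x' z -> x - sigma *: Astar y = x' + sigma *: z ->
  expands_at (psi Astar b (conjugate p) sigma x) y (b + y - A x').
Proof.
move=> zx' w d.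
exists (2^-1 * dot d d + sigma / 2 * dot (Astar d) (Astar d)) => t.
have [xt [zt [zxt wt]]] :=
  moreau p_gauge (x - sigma *: Astar (y + t *: d)) sigma_gt0.
rewrite (psi_moreau zx' w) (psi_moreau zxt wt).
have step : xt + sigma *: zt = x' + sigma *: z - (sigma * t) *: Astar d.
  rewrite -w -wt (adjoint_add _ _ A_adj) (adjoint_scale _ _ A_adj).
  by apply/colP => i; rewrite !mxE; ring.
have [zp zE] := (subdiff_gaugeP p_gauge _ _).1 zx'.
have [ztp ztE] := (subdiff_gaugeP p_gauge _ _).1 zxt.
set a := Astar d; set s := sigma * t.
pose v := sigma *: (zt - z).
have vE : x' - s *: a = xt + v.
  rewrite /v scalerBr addrA step /s.
  by apply/colP => i; rewrite !mxE; ring.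
have x'v : dot x' v <= 0.
  rewrite /v dotZr pmulr_rle0// dotDr dotNr (dotC x' z) zE dotC.
  by rewrite subr_le0.
have xtv : 0 <= dot xt v.
  rewrite /v dotZr pmulr_rge0// dotDr dotNr (dotC xt zt) ztE dotC.
  by rewrite subr_ge0.
move: v vE x'v xtv => v vE x'v xtv.
pose Q := dot xt xt - dot x' x' + 2 * (s * dot x' a).
have Q0 : 0 <= Q.
  have := dot_ge0 (xt - x').
  rewrite /Q (_ : xt = x' - s *: a - v); last by rewrite vE addrK.
  by rewrite !dotE (dotC a x') (dotC v x') (dotC v a); lra.
have Qs : Q <= s ^+ 2 * dot a a.
  have : dot (x' - s *: a) (x' - s *: a) = dot (xt + v) (xt + v) by rewrite vE.
  have := dot_ge0 v.
  by rewrite /Q !dotE (dotC a x') (dotC v xt); lra.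
have s2 : 0 < (2 * sigma)^-1 by rewrite invr_gt0 mulr_gt0.
rewrite [X in `|X|](_ : _ = 2^-1 * t ^+ 2 * dot d d + (2 * sigma)^-1 * Q).
  rewrite ger0_norm; last first.
    apply: addr_ge0; last by rewrite mulr_ge0// ltW.
    by rewrite mulr_ge0 ?dot_ge0// mulr_ge0 ?sqr_ge0// invr_ge0.
  apply: le_trans (lerD (lexx _) (ler_wpM2l (ltW s2) Qs)) _.
  rewrite le_eqVlt; apply/orP; left; apply/eqP; rewrite /s.
  by field; exact: lt0r_neq0.
rewrite /Q !dotE (dotC d y) -/a -/s /s A_adj -/a.
by field; exact: lt0r_neq0.
Qed.

Lemma grad_psi y x' z :
  subdiff p x' z -> x - sigma *: Astar y = x' + sigma *: z ->
  grad (psi Astar b (conjugate p) sigma x) y = b + y - A x'.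
Proof. by move=> zx' w; apply: grad_eq; exact: psi_expands zx' w. Qed.

End Psi.

End LeastSquares.

(** * One inexact proximal step *)

Section Step.
Context {R : realType} {n m : nat}.
Variables (A : {linear 'cV[R]_n -> 'cV[R]_m}) (Astar : 'cV[R]_m -> 'cV[R]_n).
Variables (b : 'cV[R]_m) (p : 'cV[R]_n -> R).
Hypothesis A_adj : is_adjoint A Astar.
Hypothesis p_gauge : coercive_gauge p.
Variable sigma : R.
Hypothesis sigma_gt0 : 0 < sigma.

Let h x := lsq A b x + p x.
Let Omega := primal_opt h.
Let step := resolvent_step A Astar b p sigma.

Lemma primal_objective_continuous : continuous h.
Proof.
case: p_gauge => _ _ cp _ x.
exact: (continuousD (@lsq_continuous _ _ _ A Astar b A_adj x) (cp x)).
Qed.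

Lemma primal_opt_closed : closed Omega.
Proof.
have [x xopt] := primal_opt_exists b A_adj p_gauge.
rewrite (_ : Omega = h @^-1` [set t | t <= h x]).
  apply: closed_comp; last exact: closed_le.
  by move=> u _; exact: primal_objective_continuous.
apply/seteqP; split => u /=.
  by move=> uopt; have := uopt x; rewrite /= lee_fin.
move=> ux v; rewrite /= lee_fin (le_trans ux)//.
by have := xopt v; rewrite /= lee_fin.
Qed.

(** A solution [xs] is a fixed point of the exact step, so comparison with it
    yields Fejer monotonicity up to the error. *)
Lemma resolvent_step_fejer x e x' z xs : step x e x' z -> Omega xs ->
  enorm (x' - xs) ^+ 2 + enorm (x - x') ^+ 2 <=
    enorm (x - xs) ^+ 2 + sigma / 2 * enorm e ^+ 2.
Proof.
move=> st xsopt.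
have st' := resolvent_step_opt A_adj p_gauge sigma xsopt.
have := resolvent_step_compare A_adj sigma_gt0 st st'.
rewrite !subr0 subrr subr0 !enorm_sqr => le_e.
have -> : x - xs = (x - x') + (x' - xs) by rewrite addrA subrK.
move: (x - x') (x' - xs) le_e => u v; rewrite !dotE (dotC v u); lra.
Qed.

(** When the two steps start from the same point, the inner product in the
    comparison is the opposite of the squared distance of the results. *)
Lemma resolvent_step_exact_dist x e x' z xh zh :
  step x e x' z -> step x 0 xh zh ->
  enorm (x' - xh) ^+ 2 <= sigma * enorm e ^+ 2.
Proof.
move=> st st'.
have := resolvent_step_compare A_adj sigma_gt0 st st'.
rewrite subr0 (_ : x - x' - (x - xh) = - (x' - xh)); last first.
  by apply/colP => i; rewrite !mxE; ring.
rewrite dotNl -enorm_sqr => le_e.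
have : 0 <= sigma * enorm e ^+ 2 by rewrite mulr_ge0 ?sqr_ge0// ltW.
lra.
Qed.

(** The subgradient inequality at [x'], with the quadratic term of the least
    squares kept to absorb the inner product with [e]. *)
Lemma resolvent_step_value x e x' z xs : step x e x' z ->
  h x' <= h xs + sigma^-1 * (enorm (x - x') * enorm (x' - xs)) +
          2^-1 * enorm e ^+ 2.
Proof.
move=> [zx' st]; have px := zx' xs.
have fx : lsq A b xs = lsq A b (x' + (xs - x')) by rewrite addrC subrK.
rewrite lsq_expand in fx.
have s0 := lt0r_neq0 sigma_gt0.
have cs := cauchy_schwarz (x - x') (x' - xs).
have stE : sigma^-1 * dot (x - x') (x' - xs) =
    - (dot (A x' - b) (A (xs - x')) + dot e (A (xs - x')) + dot z (xs - x')).
  rewrite st dotZl mulrA mulVf// mul1r -(opprB xs x') dotNr; congr (- _).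
  by rewrite dotDl (dotC (Astar _)) -A_adj dotC dotDl.
have cs' : sigma^-1 * dot (x - x') (x' - xs) <=
    sigma^-1 * (enorm (x - x') * enorm (x' - xs)).
  by rewrite ler_pM2l ?invr_gt0.
have := dot_ge0 (A (xs - x') - e).
rewrite enorm_sqr /h fx.
rewrite stE in cs'.
move: (A (xs - x')) cs' => v cs'.
by rewrite !dotE (dotC v e); move: cs' px; rewrite !dotE; lra.
Qed.

(** Weak duality between a step and a feasible dual point, keeping the
    quadratic term that yields uniqueness of the dual solution. *)
Lemma resolvent_step_dual_gap x e x' z y y' z' :
  step x e x' z -> y = A x' - b + e -> Astar y' + z' = 0 -> polar p z' ->
  - dot b y' - 2^-1 * enorm y' ^+ 2 + 2^-1 * enorm (y - y') ^+ 2 <=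
  - dot b y - 2^-1 * enorm y ^+ 2 + sigma^-1 * dot x' (x - x')
    + dot e (y - y').
Proof.
move=> [zx' st] yE feas z'p.
have [zp zE] := (subdiff_gaugeP p_gauge _ _).1 zx'.
have s0 := lt0r_neq0 sigma_gt0.
have bE : b = A x' - y + e by rewrite yE; apply/colP => i; rewrite !mxE; ring.
have : sigma^-1 * dot x' (x - x') = dot (A x') y + dot x' z.
  by rewrite st dotZr mulrA mulVf// mul1r dotDr A_adj yE.
have : dot (A x') y' = - dot x' z'.
  by rewrite A_adj -dotNr; congr dot; apply/eqP; rewrite -subr_eq0 opprK feas.
have : dot x' z' <= dot x' z by rewrite dotC (dotC x' z) zE; exact: z'p.
rewrite !enorm_sqr bE !dotE (dotC y' y); lra.
Qed.

End Step.

(** * Contraction under the error bound *)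

Section Rate.
Context {R : realType} {n m : nat}.
Variables (A : {linear 'cV[R]_n -> 'cV[R]_m}) (Astar : 'cV[R]_m -> 'cV[R]_n).
Variables (b : 'cV[R]_m) (p : 'cV[R]_n -> R).
Hypothesis A_adj : is_adjoint A Astar.
Hypothesis p_gauge : coercive_gauge p.
Variable sigma : R.
Hypothesis sigma_gt0 : 0 < sigma.

Let h x := lsq A b x + p x.
Let Omega := primal_opt h.
Let step := resolvent_step A Astar b p sigma.

Lemma dist_opt_attained x : exists2 v, Omega v & dist x Omega = enorm (x - v).
Proof.
apply: dist_attained.
  exact: primal_opt_closed A_adj p_gauge.
by have [v ?] := primal_opt_exists b A_adj p_gauge; exists v.
Qed.

Lemma step_exact_fejer x xh zh v : step x 0 xh zh -> Omega v ->
  enorm (xh - v) ^+ 2 + enorm (x - xh) ^+ 2 <= enorm (x - v) ^+ 2.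
Proof.
move=> st Ov; have := resolvent_step_fejer A_adj p_gauge sigma_gt0 st Ov.
by rewrite enorm0 expr0n mulr0 addr0.
Qed.

Lemma step_exact_move x xh zh : step x 0 xh zh -> enorm (x - xh) <= dist x Omega.
Proof.
move=> st; have [v Ov ->] := dist_opt_attained x.
rewrite -(@ler_pXn2r _ 2)// ?nnegrE ?enorm_ge0//.
apply: le_trans (step_exact_fejer st Ov); by rewrite lerDr sqr_ge0.
Qed.

(** The error bound at the proximal point [xh], whose residual is
    [sigma^-1 *: (x - xh)], turns Fejer monotonicity into a contraction: the
    squared distance and the squared increment add up to at most the former
    squared distance, and the error bound makes the increment at least
    [sigma / kappa] times the new distance. *)
Lemma step_exact_contraction x xh zh r kappa : step x 0 xh zh -> 0 < kappa ->
  error_bound (lsq A b) p Omega r kappa -> dist x Omega <= r ->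
  dist xh Omega <= kappa / Num.sqrt (kappa ^+ 2 + sigma ^+ 2) * dist x Omega.
Proof.
move=> st k0 eb xr; have [v Ov xv] := dist_opt_attained x.
have fej := step_exact_fejer st Ov.
have xhv : dist xh Omega <= enorm (xh - v) by exact: dist_le.
have dh0 : 0 <= dist xh Omega.
  by have [w _ ->] := dist_opt_attained xh; exact: enorm_ge0.
have xh_le : dist xh Omega <= r.
  apply: le_trans xhv _; apply: le_trans xr; rewrite xv.
  rewrite -(@ler_pXn2r _ 2)// ?nnegrE ?enorm_ge0//.
  by apply: le_trans fej; rewrite lerDl sqr_ge0.
have res : dist 0 (kktmap (lsq A b) p xh) <= sigma^-1 * enorm (x - xh).
  have [zxh stE] := st.
  have kkt : kktmap (lsq A b) p xh (sigma^-1 *: (x - xh)).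
    exists zh => //; rewrite (grad_lsq b A_adj) stE scalerA mulVf ?lt0r_neq0//.
    by rewrite scale1r addr0.
  apply: le_trans (dist_le 0 kkt) _.
  by rewrite sub0r enormN enormZ ger0_norm// invr_ge0 ltW.
have := le_trans (eb _ xh_le) (ler_wpM2l (ltW k0) res).
rewrite xv; move: (dist xh Omega) (enorm (xh - v)) (enorm (x - xh))
  (enorm (x - v)) dh0 xhv fej (enorm_ge0 (x - xh)) (enorm_ge0 (x - v)).
move=> d dv a D d0 ddv fej a0 D0 da.
have sda : sigma * d <= kappa * a.
  by rewrite -ler_pdivlMl// (le_trans da)// mulrCA.
have S0 : 0 < kappa ^+ 2 + sigma ^+ 2 by rewrite addr_gt0 ?exprn_gt0.
rewrite mulrAC ler_pdivlMr ?sqrtr_gt0//.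
have kD : 0 <= kappa * D by rewrite mulr_ge0// ltW.
rewrite -(@ler_pXn2r _ 2)// ?nnegrE ?mulr_ge0 ?sqrtr_ge0 ?(ltW k0)//.
rewrite exprMn sqr_sqrtr ?(ltW S0)//.
have sda2 : (sigma * d) ^+ 2 <= (kappa * a) ^+ 2.
  by rewrite ler_pXn2r ?nnegrE ?mulr_ge0 ?(ltW k0) ?(ltW sigma_gt0).
have ddv2 : d ^+ 2 <= dv ^+ 2.
  by rewrite ler_pXn2r ?nnegrE// (le_trans d0).
have kk : kappa ^+ 2 * (d ^+ 2 + a ^+ 2) <= kappa ^+ 2 * D ^+ 2.
  by rewrite ler_wpM2l ?sqr_ge0// (le_trans _ fej)// lerD2r.
by move: sda2 kk; rewrite !exprMn; lra.
Qed.

Section Inexact.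
Variables (x : 'cV[R]_n) (e : 'cV[R]_m) (x' z : 'cV[R]_n) (delta : R).
Hypothesis st : step x e x' z.
Hypothesis delta01 : 0 <= delta < 1.
Hypothesis e_le : sigma * enorm e ^+ 2 <= (delta * enorm (x' - x)) ^+ 2.

Lemma step_inexact_dist xh zh : step x 0 xh zh ->
  enorm (x' - xh) <= delta * enorm (x' - x).
Proof.
case/andP: delta01 => d0 _ sth.
rewrite -(@ler_pXn2r _ 2)// ?nnegrE ?mulr_ge0 ?enorm_ge0//.
exact: le_trans (resolvent_step_exact_dist A_adj sigma_gt0 st sth) e_le.
Qed.

Lemma step_inexact_move : (1 - delta) * enorm (x' - x) <= dist x Omega.
Proof.
have [xh [zh sth]] := resolvent_step_exists b A_adj p_gauge x sigma_gt0.
have := step_inexact_dist sth; have := step_exact_move sth.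
have := ler_enorm_dist x' xh x; rewrite (enormB xh x); lra.
Qed.

(** The distance of [x'] is measured to the projection [q] of the exact
    proximal point [xh]; since [enorm (x' - x)] itself involves
    [enorm (x' - q)], the inequality is solved for the latter, whence the
    denominator [1 - delta]. *)
Lemma step_inexact_contraction r kappa : 0 < kappa ->
  error_bound (lsq A b) p Omega r kappa -> dist x Omega <= r ->
  dist x' Omega <= mu kappa delta sigma * dist x Omega.
Proof.
move=> k0 eb xr; case/andP: (delta01) => d0 d1.
have [xh [zh sth]] := resolvent_step_exists b A_adj p_gauge x sigma_gt0.
have [q Oq xhq] := dist_opt_attained xh.
have := step_exact_contraction sth k0 eb xr.
have := step_inexact_dist sth; have := step_exact_move sth.
have := dist_le x' Oq.
have := ler_enorm_dist x' xh q.
have := ler_enorm_dist x' q x.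
have := ler_enorm_dist q xh x.
rewrite /mu -(mulrA (1 + delta)); set theta := kappa / Num.sqrt _.
rewrite (enormB q xh) (enormB xh x) -xhq.
move: (dist x' _) (dist xh _) (dist x _) (enorm (x' - q)) (enorm (x' - x)).
move=> dx' dxh dx a c h1 h2 h3 h4 h5 h6 h7.
apply: le_trans h4 _; rewrite mulrAC ler_pdivlMr ?subr_gt0//.
have h8 : delta * enorm (q - x) <= delta * (dxh + dx).
  by rewrite ler_wpM2l// (le_trans h1)// lerD2l.
have h9 : delta * c <= delta * (a + enorm (q - x)) by rewrite ler_wpM2l.
have h10 : delta * dxh <= delta * (theta * dx) by rewrite ler_wpM2l.
lra.
Qed.

(** In the general gap estimate, Young's inequality absorbs the error, and
    [2 * dot x' (x - x')] is at most the difference of the squared norms of [x]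
    and [x']. *)
Lemma step_inexact_dual_gap y y' z' :
  y = A x' - b + e -> Astar y' + z' = 0 -> polar p z' ->
  - dot b y' - 2^-1 * enorm y' ^+ 2 <=
  - dot b y - 2^-1 * enorm y ^+ 2 + mu'' delta sigma x x' * dist x Omega.
Proof.
move=> yE feas z'p; case/andP: (delta01) => d0 d1.
have := resolvent_step_dual_gap A_adj p_gauge sigma_gt0 st yE feas z'p.
have young : dot e (y - y') <= 2^-1 * enorm (y - y') ^+ 2 + 2^-1 * enorm e ^+ 2.
  have := dot_ge0 (e - (y - y')); move: (y - y') => v.
  by rewrite !enorm_sqr !dotE (dotC v e); lra.
have inner : 2 * dot x' (x - x') <= enorm (x' - x) * (enorm x' + enorm x).
  have := ler_enorm_dist x x' 0; rewrite !subr0 (enormB x x').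
  have := enorm_sqr x; have := enorm_sqr x'; have := enorm_sqr (x' - x).
  rewrite !dotE (dotC x x') => h1 h2 h3 h4.
  have := enorm_ge0 x; have := enorm_ge0 x'; have := sqr_ge0 (enorm (x' - x)).
  nra.
have move_le := step_inexact_move; have err_le := e_le.
set c := enorm (x' - x) in err_le move_le inner *.
have c0 : 0 <= c by exact: enorm_ge0.
have s0 := lt0r_neq0 sigma_gt0.
pose N := delta ^+ 2 * c + enorm x' + enorm x.
have N0 : 0 <= N by rewrite !addr_ge0 ?mulr_ge0 ?sqr_ge0 ?enorm_ge0.
have mu_ge : (2 * sigma)^-1 * (N * c) <= mu'' delta sigma x x' * dist x Omega.
  rewrite [leRHS](_ : _ = (2 * sigma)^-1 * (N * ((1 - delta)^-1 * dist x Omega))).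
    rewrite ler_wpM2l ?invr_ge0 ?mulr_ge0 ?(ltW sigma_gt0)//.
    by rewrite ler_wpM2l// ler_pdivlMl ?subr_gt0.
  by rewrite /mu'' -/c /N; field; rewrite s0 subr_eq0 gt_eqF.
have split_gap : sigma^-1 * dot x' (x - x') + 2^-1 * enorm e ^+ 2 <=
    (2 * sigma)^-1 * (N * c).
  have -> : sigma^-1 * dot x' (x - x') + 2^-1 * enorm e ^+ 2 =
      (2 * sigma)^-1 * (2 * dot x' (x - x') + sigma * enorm e ^+ 2) by field.
  rewrite ler_wpM2l ?invr_ge0 ?mulr_ge0 ?(ltW sigma_gt0)// /N.
  by move: err_le inner; rewrite exprMn; lra.
lra.
Qed.

End Inexact.

End Rate.

(** * The dual problem *)

Section DualSolution.
Context {R : realType} {n m : nat}.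
Variables (A : {linear 'cV[R]_n -> 'cV[R]_m}) (Astar : 'cV[R]_m -> 'cV[R]_n).
Variables (b : 'cV[R]_m) (p : 'cV[R]_n -> R).
Hypothesis A_adj : is_adjoint A Astar.
Hypothesis p_gauge : coercive_gauge p.

Lemma dual_obj_polar y z : polar p z ->
  dual_obj b (conjugate p) (y, z) = (- dot b y - 2^-1 * enorm y ^+ 2)%:E.
Proof. by move=> zp; rewrite /dual_obj/= conjugate_polar// sube0. Qed.

Lemma dual_obj_notin_polar y z : ~ polar p z ->
  dual_obj b (conjugate p) (y, z) = -oo%E.
Proof. by move=> zp; rewrite /dual_obj/= conjugate_notin_polar. Qed.

(** The dual objective is strongly concave in [y], and [z] is determined by [y]
    through feasibility: the dual solution read off a primal one is unique. *)
Lemma dual_opt_unique xbar : primal_opt (fun u => lsq A b u + p u) xbar ->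
  dual_opt Astar b (conjugate p) = [set (A xbar - b, - Astar (A xbar - b))].
Proof.
move=> xopt; set ybar := A xbar - b; set zbar := - Astar ybar.
have st := resolvent_step_opt A_adj p_gauge 1 xopt.
have [zp _] := (subdiff_gaugeP p_gauge _ _).1 st.1.
have gap y z : Astar y + z = 0 -> polar p z ->
    - dot b y - 2^-1 * enorm y ^+ 2 + 2^-1 * enorm (ybar - y) ^+ 2 <=
    - dot b ybar - 2^-1 * enorm ybar ^+ 2.
  move=> yz z'p.
  have yE : ybar = A xbar - b + 0 by rewrite addr0.
  have := resolvent_step_dual_gap A_adj p_gauge ltr01 st yE yz z'p.
  by rewrite subrr (dotC xbar) !dot0l mulr0 !addr0.
have feas : dual_feasible Astar (ybar, zbar) by rewrite /dual_feasible/= subrr.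
apply/seteqP; split => [[y z] [yz opt]|_ ->] /=.
  have := opt _ feas; rewrite (dual_obj_polar _ zp).
  have [z'p|nz] := pselect (polar p z); last first.
    by rewrite (dual_obj_notin_polar _ nz) leNgt ltNyr.
  rewrite (dual_obj_polar _ z'p) lee_fin => le_bar.
  have := gap _ _ yz z'p => le_gap.
  have : enorm (ybar - y) ^+ 2 <= 0 by lra.
  rewrite real_exprn_even_le0//= ?num_real// => /eqP/enorm_eq0/eqP.
  rewrite subr_eq0 => /eqP yE; move: yz; rewrite /dual_feasible/= -yE => yz.
  by congr pair; apply/eqP; rewrite -addr_eq0 addrC yz.
split => // -[y z] yz; rewrite (dual_obj_polar _ zp).
have [z'p|nz] := pselect (polar p z); last first.
  by rewrite dual_obj_notin_polar// leNye.
rewrite dual_obj_polar// lee_fin; apply: le_trans (gap _ _ yz z'p).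
by rewrite lerDl mulr_ge0 ?sqr_ge0// invr_ge0.
Qed.

Lemma dual_sup_le y z c : polar p z ->
  (forall y' z', Astar y' + z' = 0 -> polar p z' ->
    - dot b y' - 2^-1 * enorm y' ^+ 2 <= - dot b y - 2^-1 * enorm y ^+ 2 + c) ->
  (dual_sup Astar b (conjugate p) - dual_obj b (conjugate p) (y, z) <= c%:E)%E.
Proof.
move=> zp bnd; rewrite dual_obj_polar// leeBlDr// -EFinD.
apply: ge_ereal_sup => _ [[y' z'] yz <-].
have [z'p|nz] := pselect (polar p z'); last first.
  by rewrite dual_obj_notin_polar// leNye.
by rewrite dual_obj_polar// lee_fin (addrC c); exact: bnd yz z'p.
Qed.

End DualSolution.

(** * Convergence of the iteration *)

Lemma criterion_bound (R : realType) (sigma a c : R) : 0 < sigma -> 0 <= a ->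
  a <= c / Num.sqrt sigma -> sigma * a ^+ 2 <= c ^+ 2.
Proof.
move=> s0 a0; have ss0 : 0 < Num.sqrt sigma by rewrite sqrtr_gt0.
rewrite ler_pdivlMr// => ac.
rewrite -[X in X * _](sqr_sqrtr (ltW s0)) mulrC -exprMn.
by rewrite ler_pXn2r// nnegrE ?mulr_ge0 ?(ltW ss0)// (le_trans _ ac)// mulr_ge0// ltW.
Qed.

Section Iteration.
Context {R : realType} {n m : nat}.
Variables (A : {linear 'cV[R]_n -> 'cV[R]_m}) (Astar : 'cV[R]_m -> 'cV[R]_n).
Variables (b : 'cV[R]_m) (p : 'cV[R]_n -> R).
Hypothesis A_adj : is_adjoint A Astar.
Hypothesis p_gauge : coercive_gauge p.
Variables (sigma : nat -> R) (y : nat -> 'cV[R]_m) (z x : nat -> 'cV[R]_n).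
Hypothesis seqP : ialm_sequence Astar (conjugate p) sigma y z x.

Let h u := lsq A b u + p u.
Let Omega := primal_opt h.
Let e k := grad (psi Astar b (conjugate p) (sigma k) (x k)) (y k.+1).

Lemma sigma_ge_first k : sigma 0%N <= sigma k.
Proof. by case: seqP => _ + _ _; apply. Qed.

Lemma sigma_gt0 k : 0 < sigma k.
Proof. by case: seqP => s0 _ _ _; apply: lt_le_trans (sigma_ge_first k). Qed.

Lemma ialm_moreau k : exists x' z', [/\ subdiff p x' z',
  x k - sigma k *: Astar (y k.+1) = x' + sigma k *: z',
  x k.+1 = x' & z k.+1 = z'].
Proof.
case: seqP => _ _ zE xE; have s0 := sigma_gt0 k.
have [x' [z' [zx' w]]] := moreau p_gauge (x k - sigma k *: Astar (y k.+1)) s0.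
have zz : z k.+1 = z'.
  rewrite zE -[RHS](Prox_conjugate p_gauge s0 zx'); congr Prox.
  apply: (scalerI (lt0r_neq0 s0)).
  rewrite scalerBr scalerDr !scalerA divff ?lt0r_neq0// !scale1r.
  by rewrite w addrC.
exists x', z'; split => //.
by rewrite xE zz scalerDr opprD addrA w addrK.
Qed.

Lemma ialm_dual_residual k : y k.+1 = A (x k.+1) - b + e k.
Proof.
have [x' [z' [zx' w -> _]]] := ialm_moreau k.
rewrite /e (grad_psi b A_adj p_gauge (sigma_gt0 k) zx' w).
by apply/colP => i; rewrite !mxE; ring.
Qed.

(** The multiplier update is an inexact proximal point step on the primal
    problem, whose error is the gradient measured by the stopping criteria. *)
Lemma ialm_resolvent_step k :
  resolvent_step A Astar b p (sigma k) (x k) (e k) (x k.+1) (z k.+1).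
Proof.
have [x' [z' [zx' w xE zE]]] := ialm_moreau k; split; first by rewrite xE zE.
by rewrite -ialm_dual_residual; case: seqP => _ _ _ ->; rewrite opprB addrC subrK.
Qed.

Variable eps : nat -> R.
Hypothesis eps_ge0 : forall k, 0 <= eps k.
Hypothesis eps_cvg : cvgn (series eps).
Hypothesis critA : criterionA Astar b (conjugate p) eps sigma y x.

Lemma ialm_error_le k : sigma k * enorm (e k) ^+ 2 <= eps k ^+ 2.
Proof. exact: criterion_bound (sigma_gt0 k) (enorm_ge0 _) (critA k). Qed.

Lemma ialm_fejer_sqr k xs : Omega xs ->
  enorm (x k.+1 - xs) ^+ 2 + enorm (x k - x k.+1) ^+ 2 <=
  enorm (x k - xs) ^+ 2 + eps k ^+ 2.
Proof.
move=> xsopt.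
have := resolvent_step_fejer A_adj p_gauge (sigma_gt0 k) (ialm_resolvent_step k) xsopt.
have := ialm_error_le k; have := sqr_ge0 (eps k); lra.
Qed.

Lemma ialm_fejer k xs : Omega xs ->
  enorm (x k.+1 - xs) <= enorm (x k - xs) + eps k.
Proof.
move=> /(ialm_fejer_sqr k) fej.
rewrite -(@ler_pXn2r _ 2)// ?nnegrE ?addr_ge0 ?enorm_ge0// sqrrD.
have := mulr_ge0 (enorm_ge0 (x k - xs)) (eps_ge0 k).
have := sqr_ge0 (enorm (x k - x k.+1)); lra.
Qed.

Lemma ialm_dist_is_cvgn xs : Omega xs -> cvgn (fun k => enorm (x k - xs)).
Proof.
move=> xsopt; apply: quasi_decreasing_is_cvgn eps_ge0 eps_cvg _.
  by move=> k; exact: enorm_ge0.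
by move=> k; exact: ialm_fejer.
Qed.

Lemma ialm_dist_le k xs : Omega xs ->
  enorm (x k - xs) <= enorm (x 0%N - xs) + limn (series eps).
Proof.
move=> xsopt.
have qd := @quasi_decreasing_le _ (fun k => enorm (x k - xs)) eps k
  (fun j => ialm_fejer j xsopt).
by apply: le_trans qd _; rewrite lerD2l series_le_lim.
Qed.

Let eps_cvg0 : eps k @[k --> \oo] --> 0.
Proof. exact: cvg_series_cvg_0. Qed.

Let eps_sqr_cvg0 : eps k ^+ 2 @[k --> \oo] --> 0.
Proof. by rewrite -(expr0n R 2 : 0 ^+ 2 = 0); exact: cvg_sqr eps_cvg0. Qed.

(** The squared increments are dominated by the decrease of the squared
    distances to a solution, which converge, plus [eps k ^+ 2]. *)
Lemma ialm_increment_cvg0 : enorm (x k - x k.+1) @[k --> \oo] --> 0.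
Proof.
have [xs xsopt] := primal_opt_exists b A_adj p_gauge.
apply: cvg_sqr0 => [k|]; first exact: enorm_ge0.
have cl := ialm_dist_is_cvgn xsopt; set l := limn _ in cl.
have clS : enorm (x k.+1 - xs) @[k --> \oo] --> l.
  by rewrite (cvg_shiftS (fun k => enorm (x k - xs))).
apply: (@squeeze_cvgr _ _ _ _ (cst 0) (fun k => enorm (x k - xs) ^+ 2 -
    enorm (x k.+1 - xs) ^+ 2 + eps k ^+ 2)); last first.
- have -> : 0 = l ^+ 2 - l ^+ 2 + 0 by ring.
  apply: cvgD => //; apply: cvgB; exact: cvg_sqr.
- exact: cvg_cst.
apply: nearW => k; rewrite sqr_ge0/=.
by have := ialm_fejer_sqr k xsopt; lra.
Qed.

Lemma ialm_error_cvg0 : enorm (e k) @[k --> \oo] --> 0.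
Proof.
have s0 := sigma_gt0 0%N.
apply: cvg_sqr0 => [k|]; first exact: enorm_ge0.
apply: (@squeeze_cvgr _ _ _ _ (cst 0) (fun k => (sigma 0%N)^-1 * eps k ^+ 2)).
- apply: nearW => k; rewrite sqr_ge0/= ler_pdivlMl//.
  apply: le_trans (ialm_error_le k).
  by rewrite ler_wpM2r ?sqr_ge0// sigma_ge_first.
- exact: cvg_cst.
by rewrite -(mulr0 (sigma 0%N)^-1); apply: cvgM => //; exact: cvg_cst.
Qed.

Lemma ialm_value_cvg xs : Omega xs -> h (x k) @[k --> \oo] --> h xs.
Proof.
move=> xsopt; rewrite -(cvg_shiftS (fun k => h (x k)))/=.
have s0 := sigma_gt0 0%N.
pose B := enorm (x 0%N - xs) + limn (series eps).
apply: (@squeeze_cvgr _ _ _ _ (cst (h xs)) (fun k => h xs +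
    (sigma 0%N)^-1 * (enorm (x k - x k.+1) * B) + 2^-1 * enorm (e k) ^+ 2)).
- apply: nearW => k; apply/andP; split.
    by have := xsopt (x k.+1); rewrite /= lee_fin.
  apply: le_trans (resolvent_step_value A_adj (sigma_gt0 k) xs
    (ialm_resolvent_step k)) _.
  rewrite lerD2r lerD2l; apply: ler_pM.
  + by rewrite invr_ge0 ltW// sigma_gt0.
  + by rewrite mulr_ge0 ?enorm_ge0.
  + by rewrite lef_pV2 ?posrE ?sigma_gt0// sigma_ge_first.
  + by rewrite ler_wpM2l ?enorm_ge0// ialm_dist_le.
- exact: cvg_cst.
suff: h xs + (sigma 0%N)^-1 * (enorm (x k - x k.+1) * B) +
    2^-1 * enorm (e k) ^+ 2 @[k --> \oo] -->
    h xs + (sigma 0%N)^-1 * (0 * B) + 2^-1 * 0 ^+ 2.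
  by rewrite mul0r mulr0 expr0n mulr0 !addr0.
apply: cvgD; first apply: cvgD; first exact: cvg_cst.
  apply: cvgM; first exact: cvg_cst.
  by apply: cvgM; [exact: ialm_increment_cvg0 | exact: cvg_cst].
by apply: cvgM; [exact: cvg_cst | apply: cvg_sqr; exact: ialm_error_cvg0].
Qed.

(** A cluster point is optimal because the objective values converge to the
    minimum; quasi-Fejer monotonicity with respect to it then excludes any
    other cluster point. *)
Lemma ialm_primal_cvg : exists2 xbar, Omega xbar & x @ \oo --> xbar.
Proof.
have [xs xsopt] := primal_opt_exists b A_adj p_gauge.
have [u xu] : exists u : 'cV[R]_n, cluster (x @ \oo) u.
  apply: (@bounded_cluster _ _ _ (enorm (x 0%N - xs) + limn (series eps) + enorm xs)).
  move=> k; rewrite -[x k](subrK xs); apply: le_trans (ler_enormD _ _) _.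
  by rewrite lerD2r ialm_dist_le.
have uopt : Omega u.
  have hu : h u = h xs := cluster_lim (primal_objective_continuous A_adj p_gauge (b := b)) xu
    (ialm_value_cvg xsopt).
  move=> v; rewrite /= lee_fin -[leLHS]/(h u) hu.
  by have := xsopt v; rewrite /= lee_fin.
exists u => //; apply: cvg_enorm.
have cl := ialm_dist_is_cvgn uopt.
have lim0 := cluster_lim (@enorm_sub_continuous _ _ u) xu cl.
by move: cl; rewrite -lim0 subrr enorm0.
Qed.

(** [z k.+1] is the increment divided by [sigma k] minus [Astar (y k.+1)], and
    [sigma] is bounded away from zero. *)
Lemma ialm_dual_cvg xbar : Omega xbar -> x @ \oo --> xbar ->
  (fun k => (y k, z k)) @ \oo -->
    (A xbar - b, - Astar (A xbar - b)).
Proof.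
move=> xopt xcvg.
have xScvg : x k.+1 @[k --> \oo] --> xbar by rewrite (cvg_shiftS x).
have Acvg : A (x k.+1) @[k --> \oo] --> A xbar.
  apply: (cvg_comp (fun k => x k.+1) A xScvg).
  exact: adjoint_continuous A_adj xbar.
have ecvg : e @ \oo --> (0 : 'cV[R]_m).
  apply: cvg_enorm; under eq_fun do rewrite subr0.
  exact: ialm_error_cvg0.
have ycvg : y k.+1 @[k --> \oo] --> A xbar - b.
  rewrite (_ : (fun k => y k.+1) = fun k => A (x k.+1) - b + e k).
    rewrite -[X in _ --> X]addr0; apply: cvgD => //.
    by apply: cvgB => //; exact: cvg_cst.
  by apply/funext => k; exact: ialm_dual_residual.
have dcvg : (sigma k)^-1 *: (x k - x k.+1) @[k --> \oo] --> (0 : 'cV[R]_n).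
  apply: cvg_enorm; under eq_fun do rewrite subr0 enormZ.
  apply: (@squeeze_cvgr _ _ _ _ (cst 0)
    (fun k => (sigma 0%N)^-1 * enorm (x k - x k.+1))).
  - apply: nearW => k; rewrite mulr_ge0 ?enorm_ge0//= ler_wpM2r ?enorm_ge0//.
    rewrite ger0_norm ?invr_ge0 ?(ltW (sigma_gt0 k))//.
    by rewrite lef_pV2 ?posrE ?sigma_gt0// sigma_ge_first.
  - exact: cvg_cst.
  rewrite -(mulr0 (sigma 0%N)^-1); apply: cvgM; first exact: cvg_cst.
  exact: ialm_increment_cvg0.
have zcvg : z k.+1 @[k --> \oo] --> - Astar (A xbar - b).
  rewrite (_ : (fun k => z k.+1) =
      fun k => (sigma k)^-1 *: (x k - x k.+1) - Astar (y k.+1)).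
    rewrite -[X in _ --> X]add0r; apply: cvgB => //.
    apply: (cvg_comp (fun k => y k.+1) Astar ycvg).
    exact: adjoint_continuous (adjoint_sym A_adj) _.
  apply/funext => k; have [_] := ialm_resolvent_step k.
  rewrite -ialm_dual_residual => ->.
  by rewrite scalerA mulVf ?lt0r_neq0 ?sigma_gt0// scale1r addrC addKr.
have ycvg' : y @ \oo --> A xbar - b by rewrite -(cvg_shiftS y).
have zcvg' : z @ \oo --> - Astar (A xbar - b) by rewrite -(cvg_shiftS z).
exact: (cvg_pair ycvg' zcvg').
Qed.

End Iteration.

(** * Limits of the rates *)

Section RateLimits.
Context {R : realType} {n : nat}.
Variables (kappa : R) (delta sigma : nat -> R).
Hypothesis kappa_gt0 : 0 < kappa.
Hypothesis sigma_gt0 : forall k, 0 < sigma k.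
Hypothesis sigmay : sigma @ \oo --> +oo.
Hypothesis delta0 : delta @ \oo --> 0.

Let sigmaV0 : (sigma k)^-1 @[k --> \oo] --> 0.
Proof. by apply/gtr0_cvgV0 => //; exact: nearW. Qed.

Let oneB_delta : (1 - delta k)^-1 @[k --> \oo] --> (1 : R).
Proof.
rewrite -[X in _ --> X]invr1; apply: cvgV; first exact: oner_neq0.
rewrite -[X in _ --> X](subr0 1); apply: cvgB => //; exact: cvg_cst.
Qed.

Lemma mu_cvg0 : mu kappa (delta k) (sigma k) @[k --> \oo] --> 0.
Proof.
suff : mu kappa (delta k) (sigma k) @[k --> \oo] --> (0 + (1 + 0) * kappa * 0) * 1.
  by rewrite mulr0 addr0 mul0r.
apply: cvgM => //; apply: cvgD => //; apply: cvgM.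
  by apply: cvgM; [apply: cvgD => //; exact: cvg_cst | exact: cvg_cst].
apply: (@squeeze_cvgr _ _ _ _ (cst 0) (fun k => (sigma k)^-1)) => //.
  apply: nearW => k; have sk := sigma_gt0 k.
  rewrite invr_ge0 sqrtr_ge0/= lef_pV2 ?posrE ?sqrtr_gt0 ?addr_gt0 ?exprn_gt0//.
  rewrite -[leLHS](ger0_norm (ltW sk)) -sqrtr_sqr ler_wsqrtr//.
  by rewrite lerDr sqr_ge0.
exact: cvg_cst.
Qed.

Lemma mu'_cvg0 : mu' (delta k) (sigma k) @[k --> \oo] --> 0.
Proof.
rewrite (_ : (fun k => _) = fun k => (1 - delta k)^-1 * (sigma k)^-1).
  by rewrite -(mulr0 1); apply: cvgM.
by apply/funext => k; rewrite /mu' mul1r invfM.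
Qed.

Lemma mu''_cvg0 (x : nat -> 'cV[R]_n) (xbar : 'cV[R]_n) : x @ \oo --> xbar ->
  mu'' (delta k) (sigma k) (x k) (x k.+1) @[k --> \oo] --> 0.
Proof.
move=> xcvg.
have ncvg : enorm (x k) @[k --> \oo] --> enorm xbar.
  by apply: (cvg_comp x (@enorm R n) xcvg); exact: enorm_continuous.
have ncvgS : enorm (x k.+1) @[k --> \oo] --> enorm xbar.
  by rewrite (cvg_shiftS (fun k => enorm (x k))).
have xScvg : x k.+1 @[k --> \oo] --> xbar by rewrite (cvg_shiftS x).
have dcvg : enorm (x k.+1 - x k) @[k --> \oo] --> enorm (xbar - xbar).
  apply: (cvg_comp (fun k => x k.+1 - x k) (@enorm R n) (cvgB xScvg xcvg)).
  exact: enorm_continuous.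
rewrite (_ : (fun k => _) = fun k =>
    (delta k ^+ 2 * enorm (x k.+1 - x k) + enorm (x k.+1) + enorm (x k)) *
    (2^-1 * mu' (delta k) (sigma k))).
  suff : (delta k ^+ 2 * enorm (x k.+1 - x k) + enorm (x k.+1) + enorm (x k)) *
      (2^-1 * mu' (delta k) (sigma k)) @[k --> \oo] -->
      (0 ^+ 2 * enorm (xbar - xbar) + enorm xbar + enorm xbar) * (2^-1 * 0).
    by rewrite !mulr0.
  apply: cvgM.
    apply: cvgD => //; apply: cvgD => //; apply: cvgM => //; exact: cvg_sqr.
  by apply: cvgM; [exact: cvg_cst | exact: mu'_cvg0].
by apply/funext => k; rewrite /mu'' /mu' mul1r -invfM mulrA.
Qed.

End RateLimits.

Theorem theorem4p1 (R : realType) (n m g : nat)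
    (A : {linear 'cV[R]_n -> 'cV[R]_m}) (Astar : 'cV[R]_m -> 'cV[R]_n)
    (b : 'cV[R]_m) (lambda1 lambda2 : R)
    (G : 'I_g -> {set 'I_n}) (w : 'I_g -> R)
    (sigma : nat -> R) (y : nat -> 'cV[R]_m) (z x : nat -> 'cV[R]_n)
    (eps : nat -> R) :
  is_adjoint A Astar ->
  0 <= lambda1 -> 0 <= lambda2 -> 0 < lambda1 + lambda2 ->
  injective G -> finset.partition [set G l | l : 'I_g]%SET [set: 'I_n]%SET ->
  (forall l, 0 < w l) ->
  let p := reg lambda1 lambda2 G w in
  let f := lsq A b in
  let OmegaP := primal_opt (fun u => f u + p u) in
  let pstar := conjugate p in
  ialm_sequence Astar pstar sigma y z x ->
  (forall k, 0 <= eps k) -> cvgn (series eps) ->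
  criterionA Astar b pstar eps sigma y x ->
  [/\ (exists2 xbar, OmegaP xbar & x @ \oo --> xbar),
      (exists2 yzbar, dual_opt Astar b pstar = [set yzbar] &
         (fun k => (y k, z k)) @ \oo --> yzbar) &
      forall (delta : nat -> R) (alpha r kappa : R),
        (forall k, 0 <= delta k < 1) -> cvgn (series delta) ->
        limn (series eps) <= alpha -> 0 < r -> alpha < r ->
        0 < kappa -> error_bound f p OmegaP r kappa ->
        (criterionB Astar b pstar delta sigma y x ->
         dist (x 0%N) OmegaP <= r - alpha ->
         forall k,
           [/\ dist (x k.+1) OmegaP
                 <= mu kappa (delta k) (sigma k) * dist (x k) OmegaP,
               enorm (Astar (y k.+1) + z k.+1)
                 <= mu' (delta k) (sigma k) * dist (x k) OmegaP &
               (dual_sup Astar b pstar - dual_obj b pstar (y k.+1, z k.+1)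
                 <= (mu'' (delta k) (sigma k) (x k) (x k.+1)
                     * dist (x k) OmegaP)%:E)%E]) /\
        (sigma @ \oo --> +oo ->
         [/\ (fun k => mu kappa (delta k) (sigma k)) @ \oo --> (0 : R),
             (fun k => mu' (delta k) (sigma k)) @ \oo --> (0 : R) &
             (fun k => mu'' (delta k) (sigma k) (x k) (x k.+1)) @ \oo
               --> (0 : R)])].
Proof.
move=> A_adj l1 l2 l12 _ Gpart w0 p f OmegaP pstar seqP eps0 ceps critA.
have p_gauge : coercive_gauge p by exact: reg_coercive_gauge.
have [xbar xopt xcvg] := ialm_primal_cvg A_adj p_gauge seqP eps0 ceps critA.
split; first by exists xbar.
  exists (A xbar - b, - Astar (A xbar - b)).
    exact: (dual_opt_unique A_adj p_gauge xopt).
  exact: (ialm_dual_cvg A_adj p_gauge seqP eps0 ceps critA xopt xcvg).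
move=> delta alpha r kappa d01 cdelta sum_le r0 ar k0 eb.
have s0 k : 0 < sigma k by exact: (sigma_gt0 seqP k).
split=> [critB x0_le k|sigmay]; last first.
  have d0 : delta @ \oo --> 0 by exact: cvg_series_cvg_0.
  by split; [exact: mu_cvg0|exact: mu'_cvg0|exact: (mu''_cvg0 s0 sigmay d0 xcvg)].
have st := ialm_resolvent_step b A_adj p_gauge seqP k.
have critBk := critB k; rewrite mulrAC in critBk.
have err := criterion_bound (s0 k) (enorm_ge0 _) critBk.
have x_le : dist (x k) OmegaP <= r.
  have [v Ov x0v] := dist_opt_attained b A_adj p_gauge (x 0%N).
  apply: le_trans (dist_le _ Ov) _.
  apply: le_trans (ialm_dist_le A_adj p_gauge seqP eps0 ceps critA k Ov) _.
  by rewrite -x0v; move: x0_le sum_le; rewrite -/OmegaP; lra.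
have move_le := step_inexact_move A_adj p_gauge (s0 k) st (d01 k) err.
have d1 : 0 < 1 - delta k by have /andP[_] := d01 k; rewrite subr_gt0.
split.
- exact: (step_inexact_contraction A_adj p_gauge (s0 k) st (d01 k) err k0 eb x_le).
- have dE : enorm (x k.+1 - x k) = sigma k * enorm (Astar (y k.+1) + z k.+1).
    case: seqP => _ _ _ ->.
    by rewrite addrAC subrr sub0r enormN enormZ gtr0_norm.
  rewrite dE in move_le; rewrite /mu' mul1r mulrC ler_pdivlMr ?mulr_gt0//.
  by rewrite mulrC -mulrA.
- apply: dual_sup_le => //; first by have [/(subdiff_gaugeP p_gauge)[]] := st.
  move=> y' z' yz z'p.
  exact: (step_inexact_dual_gap A_adj p_gauge (s0 k) st (d01 k) err
    (ialm_dual_residual b A_adj p_gauge seqP k) yz z'p).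
Qed.
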